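(* Let $(K,\nu)$ be a valued field, let $\omega$ be a valuation transcendental extension of $\nu$ to the rational function field $K(x)$, and let $K(a)$ be a minimal field of definition for $\omega$. Take an extension $\overline{\omega}$ of $\omega$ to $\overline{K}(x)$ which has $(a,\gamma)$ as a minimal pair of definition for some $\gamma\in\overline{\omega}\,\overline{K}(x)$, and fix an extension of $\overline{\omega}$ to $\overline{K(x)}$. Take $b_1,b_2\in\overline{K}$ such that $K(b_1)=K(a)\cap K^i$ and $K(b_2)=K(a)\cap K^r$, where $K^i$ and $K^r$ are the absolute inertia field and the absolute ramification field of $(K,\nu)$. If $\omega$ is residue transcendental, then $$K(b_1)^h\subseteq IC(K(x)|K,\omega)\subseteq K(a)^h.$$ If $\omega$ is value transcendental, then $$K(b_2)^h\subseteq IC(K(x)|K,\omega)\subseteq K(a)^h.$$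
   Context: Values are written additively, $\nu 0=\infty$; for a valued field $(L,\nu)$, $\nu L$ and $L\nu$ denote the value group and residue field. $\overline{K}$ is a fixed algebraic closure of $K$. An extension $\omega$ of $\nu$ to $K(x)$ is value transcendental if $\dim_{\mathbb{Q}}\big((\omega K(x)/\nu K)\otimes_{\mathbb{Z}}\mathbb{Q}\big)=1$, residue transcendental if $\mathrm{trdeg}[K(x)\omega:K\nu]=1$, and valuation transcendental if it is one of these. Given an extension $\overline{\omega}$ of $\omega$ to $\overline{K}(x)$, write $\overline{\nu}$ for its restriction to $\overline{K}$. For $a\in\overline{K}$ and $\gamma$ in an ordered abelian group containing $\overline{\nu}\,\overline{K}$, $\overline{\nu}_{a,\gamma}$ is the valuation on $\overline{K}(x)$ determined by $\overline{\nu}_{a,\gamma}\big(\sum_i c_i(x-a)^i\big)=\min_i\{\overline{\nu}c_i+i\gamma\}$ ($c_i\in\overline{K}$). A pair $(a,\gamma)$ with $a\in\overline{K}$, $\gamma\in\overline{\omega}\,\overline{K}(x)$ is a pair of definition for $\omega$ (with respect to $\overline{\omega}$) if $\overline{\omega}=\overline{\nu}_{a,\gamma}$; it is a minimal pair of definition if moreover for every $b\in\overline{K}$, $\overline{\nu}(a-b)\geq\gamma$ implies $[K(a):K]\leq[K(b):K]$. A minimal field of definition for $\omega$ is a field $K(a)$ where $(a,\gamma)$ is a minimal pair of definition for $\omega$ (with respect to some such extension $\overline{\omega}$). Let $G=\mathrm{Gal}(\overline{K}|K)$ and $K^{\mathrm{sep}}$ the separable closure of $K$ in $\overline K$, with valuation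 ring $\mathcal{O}_{K^{\mathrm{sep}}}$ with respect to $\overline{\nu}$. The absolute inertia field $K^i$ is the fixed field in $K^{\mathrm{sep}}$ of $\{\sigma\in G\mid \overline{\nu}(\sigma c-c)>0\ \forall c\in\mathcal{O}_{K^{\mathrm{sep}}}\}$; the absolute ramification field $K^r$ is the fixed field in $K^{\mathrm{sep}}$ of $\{\sigma\in G\mid \overline{\nu}(\sigma c-c)>\overline{\nu}c\ \forall c\in K^{\mathrm{sep}}\setminus\{0\}\}$. For $L|K$ algebraic, $L\subseteq\overline{K}$, $L^h$ is the henselization of $L$ inside $\overline{K}$ with respect to $\overline{\nu}$. $K(x)^h$ is the henselization of $(K(x),\omega)$ inside $\overline{K(x)}$ with respect to the fixed extension of $\overline{\omega}$, where $\overline{K(x)}$ is an algebraic closure of $\overline{K}(x)$. The implicit constant field is $IC(K(x)|K,\omega):=\overline{K}\cap K(x)^h$. *)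

(* Defs.v *)
From HB Require Import structures.
From mathcomp Require Import all_boot all_order all_algebra.
From mathcomp Require Import ring_quotient separable boolp mpoly.

Set Implicit Arguments.
Unset Strict Implicit.
Unset Printing Implicit Defensive.

Import Order.TTheory GRing.Theory Num.Theory.
Local Open Scope ring_scope.

(* Totally ordered abelian groups, written additively; in MathComp a
   porderZmodType has no compatibility between the order and the addition. *)
Record oagType := OrderedAbelianGroup {
  oag_sort :> porderZmodType;
  oag_total : total (<=%R : rel oag_sort);
  oag_lerD2r : forall z x y : oag_sort, x <= y -> x + z <= y + z
}.

(* Gamma together with a largest element: None is the value infinity. *)
Definition lev (Gamma : oagType) (s t : option Gamma) : bool :=
  match s, t with
  | _, None => true
  | None, Some _ => false
  | Some g, Some h => g <= h
  end.

Definition ltv (Gamma : oagType) (s t : option Gamma) : bool := ~~ lev t s.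

Definition minv (Gamma : oagType) (s t : option Gamma) : option Gamma :=
  if lev s t then s else t.

Definition addv (Gamma : oagType) (s t : option Gamma) : option Gamma :=
  match s, t with
  | Some g, Some h => Some (g + h)
  | _, _ => None
  end.

Lemma oag_double_eq0 (Gamma : oagType) (g : Gamma) : g + g = 0 -> g = 0.
Proof.
move=> gg; have /orP[ge0|le0] := oag_total 0 g; apply/le_anti.
  by have := oag_lerD2r g ge0; rewrite ge0 andbT add0r gg.
by have := oag_lerD2r g le0; rewrite le0 /= add0r gg.
Qed.

Lemma oag_addr_ge0 (Gamma : oagType) (g h : Gamma) : 0 <= g -> h <= g + h.
Proof. by move=> /(oag_lerD2r h); rewrite add0r. Qed.

Lemma oag_ltNge (Gamma : oagType) (g h : Gamma) : (g < h) = ~~ (h <= g).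
Proof.
have [le_hg|nle] := boolP (h <= g); first by rewrite le_gtF.
rewrite lt_neqAle; have := oag_total g h; rewrite (negPf nle) orbF => ->.
by rewrite andbT; apply: contraNneq nle => ->.
Qed.

Lemma lev_trans (Gamma : oagType) (s t u : option Gamma) :
  lev s t -> lev t u -> lev s u.
Proof. by case: s t u => [g|] [h|] [k|] //=; apply: le_trans. Qed.

Lemma ltv_lev_trans (Gamma : oagType) (s t u : option Gamma) :
  ltv s t -> lev t u -> ltv s u.
Proof.
by move=> lt_st le_tu; apply: contra lt_st => le_us; apply: lev_trans le_us.
Qed.

Lemma ltv_min (Gamma : oagType) (s t u : option Gamma) :
  ltv s t -> ltv s u -> ltv s (minv t u).
Proof. by rewrite /minv; case: ifP. Qed.

Lemma lev_min (Gamma : oagType) (s t u : option Gamma) :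
  lev s t -> lev s u -> lev s (minv t u).
Proof. by rewrite /minv; case: ifP. Qed.

Lemma lev_addr (Gamma : oagType) (s t : option Gamma) :
  lev (Some 0) s -> lev t (addv s t).
Proof. by case: s t => [g|] [h|] //=; apply: oag_addr_ge0. Qed.

(* w is a valuation on the subfield F; its values outside F are irrelevant. *)
Definition valuation_on (L : fieldType) (Gamma : oagType) (F : {pred L})
    (w : L -> option Gamma) : Prop :=
  [/\ {in F, forall y, w y = None <-> y = 0},
      {in F &, forall y z, w (y * z) = addv (w y) (w z)}
    & {in F &, forall y z, lev (minv (w y) (w z)) (w (y + z))}].

Record valuation (L : fieldType) (Gamma : oagType) := Valuation {
  valfun :> L -> option Gamma;
  valfunP : valuation_on predT valfun
}.

(* The subfield generated by a subset; subfields are the subsets F such that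
   divring_closed F. *)
Definition subfield_gen (L : fieldType) (S : {pred L}) : {pred L} :=
  [pred z | `[< forall M : {pred L},
     divring_closed M -> {subset S <= M} -> z \in M >]].

Definition adjoin (L : fieldType) (F : {pred L}) (a : L) : {pred L} :=
  subfield_gen [predU1 a & F].

(* The elements of L that are algebraic over F; if L is algebraically closed,
   this is the algebraic closure of F in L. *)
Definition algcl (L : fieldType) (F : {pred L}) : {pred L} :=
  [pred z | `[< exists p : {poly L}, [/\ p \is a polyOver F, p != 0
                                       & root p z] >]].

Definition sepcl (L : fieldType) (F : {pred L}) : {pred L} :=
  [pred z | `[< exists p : {poly L}, [/\ p \is a polyOver F,
                                         separable_poly p & root p z] >]].

(* [E : F] = n *)
Definition degree_is (L : fieldType) (F E : {pred L}) (n : nat) : Prop :=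
  exists e : 'I_n -> L,
    (forall i, e i \in E) /\
    {in E, forall z, exists! c : {ffun 'I_n -> L},
       (forall i, c i \in F) /\ z = \sum_(i < n) c i * e i}.

(* trdeg [E : F] = n: E | F has a transcendence basis with n elements. *)
Definition trdeg_is (L : fieldType) (F E : {pred L}) (n : nat) : Prop :=
  exists t : 'I_n -> L,
    [/\ forall i, t i \in E,
        forall p : {mpoly L[n]}, p \is a mpolyOver n F -> p.@[t] = 0 -> p = 0
      & {subset E <= algcl (subfield_gen [predU F & [pred z in codom t]])}].

(* s restricts to an automorphism of E over F; its values outside E are
   irrelevant. *)
Definition automorphism_over (L : fieldType) (F E : {pred L}) (s : L -> L) :
    Prop :=
  [/\ {in E, forall z, s z \in E},
      {in E, forall z, exists2 y, y \in E & s y = z},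
      {in E &, forall y z, s (y + z) = s y + s z},
      {in E &, forall y z, s (y * z) = s y * s z}
    & {in F, forall z, s z = z}].

Section ResidueField.
Context (L : fieldType) (Gamma : oagType) (v : valuation L Gamma).

Lemma val0E y : (v y = None) <-> (y = 0).
Proof. by case: (valfunP v) => H _ _; apply: H. Qed.

Lemma valM y z : v (y * z) = addv (v y) (v z).
Proof. by case: (valfunP v) => _ H _; apply: H. Qed.

Lemma valD y z : lev (minv (v y) (v z)) (v (y + z)).
Proof. by case: (valfunP v) => _ _ H; apply: H. Qed.

Lemma val1 : v 1 = Some 0.
Proof.
case v1: (v 1) => [g|]; last by move/val0E/eqP: v1; rewrite oner_eq0.
have := valM 1 1; rewrite mulr1 v1 /= => -[/esym/eqP].
by rewrite -subr_eq0 addrK => /eqP->.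
Qed.

Lemma valN y : v (- y) = v y.
Proof.
have vN1 : v (-1) = Some 0.
  case vm: (v (-1)) => [g|]; last first.
    by move/val0E/eqP: vm; rewrite oppr_eq0 oner_eq0.
  have := valM (-1) (-1); rewrite mulrNN mulr1 val1 vm /= => -[/esym].
  by move/oag_double_eq0->.
by rewrite -mulN1r valM vN1; case: (v y) => //= g; rewrite add0r.
Qed.

Definition valring_pred : {pred L} := [pred z | lev (Some 0) (v z)].

Lemma valring_closed : subring_closed valring_pred.
Proof.
split; rewrite ?inE ?val1 //=.
- move=> y z; rewrite !inE => y0 z0.
  by apply: lev_trans (valD y (- z)); rewrite valN; apply: lev_min.
- move=> y z; rewrite !inE valM => y0 z0.
  exact: lev_trans z0 (lev_addr _ y0).
Qed.

HB.instance Definition _ :=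
  GRing.isSubringClosed.Build L valring_pred valring_closed.

Record valring := ValRing { valring_val : L; _ : valring_val \in valring_pred }.

HB.instance Definition _ := [isSub for valring_val].
HB.instance Definition _ := [Choice of valring by <:].
HB.instance Definition _ := [SubChoice_isSubComNzRing of valring by <:].

Definition maxideal : {pred valring} :=
  [pred z : valring | ltv (Some 0) (v (\val z))].

Lemma maxideal_closed : idealr_closed maxideal.
Proof.
split; rewrite ?inE.
- by rewrite (_ : v (\val 0) = None) //; apply/val0E; rewrite raddf0.
- by rewrite rmorph1 val1 /ltv /= lexx.
move=> [y Oy] z t; rewrite !inE rmorphD rmorphM /= => z0 t0.
apply: ltv_lev_trans (valD _ _); apply: ltv_min => //.
by rewrite valM; apply: ltv_lev_trans z0 (lev_addr _ Oy).
Qed.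

HB.instance Definition _ :=
  isIdealr.Build valring maxideal maxideal_closed.

Definition resfield := {ideal_quot maxideal}.
HB.instance Definition _ := GRing.ComNzRing.on resfield.

Definition residue (z : valring) : resfield := (\pi_{ideal_quot maxideal} z)%qT.

Lemma residue_eq0 z : (residue z == 0) = (z \in maxideal).
Proof.
have -> : (0 : resfield) = residue 0 by rewrite /residue rmorph0.
by rewrite -[in RHS](subr0 z) Quotient.idealrBE.
Qed.

Lemma residueM y z : residue (y * z) = residue y * residue z.
Proof. exact: rmorphM. Qed.

Lemma residue1 : residue 1 = 1.
Proof. exact: rmorph1. Qed.

Lemma residueK q : residue (repr q) = q.
Proof. exact: reprK. Qed.

Lemma valring_inv_mem (z : valring) :
  z \notin maxideal -> (\val z)^-1 \in valring_pred.
Proof.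
rewrite !inE negbK => zle0; have z0 : \val z != 0.
  by apply: contraTneq zle0 => /val0E->.
have := valM (\val z) (\val z)^-1; rewrite divff // val1.
case: (v (\val z)) (v _^-1) zle0 => [g|] [h|] //= g0 [->].
by have := oag_lerD2r h g0; rewrite add0r.
Qed.

Definition resinv (q : resfield) : resfield :=
  if q == 0 then 0 else residue (insubd (0 : valring) (\val (repr q))^-1).

Lemma mulVres (q : resfield) : q != 0 -> resinv q * q = 1.
Proof.
move=> q0; rewrite /resinv (negPf q0) -[X in _ * X]residueK -residueM -residue1.
move: q0; rewrite -[q in q != 0]residueK residue_eq0 => /[dup] q0.
move=> /valring_inv_mem Oq; congr residue; apply: val_inj.
rewrite rmorphM rmorph1 /= val_insubd Oq mulVf //.
by apply: contraNneq q0 => z0; rewrite inE /= z0 (_ : v 0 = None) //; apply/val0E.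
Qed.

Lemma resinv0 : resinv 0 = 0.
Proof. by rewrite /resinv eqxx. Qed.

HB.instance Definition _ :=
  GRing.ComNzRing_isField.Build resfield mulVres resinv0.

(* The residue field of the subfield F, as a subfield of that of L. *)
Definition res_subfield (F : {pred L}) : {pred resfield} :=
  [pred q | `[< exists2 z : valring, \val z \in F & residue z = q >]].

Definition value_group (F : {pred L}) : {pred Gamma} :=
  [pred g | `[< exists2 z, z \in F & v z = Some g >]].

End ResidueField.

Arguments res_subfield {L Gamma} v F.

(* For subgroups B <= A of Gamma, dim_Q ((A / B) (x) Q) = n: as every Q-basis
   can be scaled into the image of A, this says that there are n elements of A
   whose images form a Q-basis of (A / B) (x) Q. *)
Definition dimQ_quotient_is (Gamma : oagType) (B A : {pred Gamma}) (n : nat) :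
    Prop :=
  exists e : 'I_n -> Gamma,
    [/\ forall i, e i \in A,
        forall m : 'I_n -> int, \sum_(i < n) e i *~ m i \in B ->
          forall i, m i = 0
      & {in A, forall g, exists (k : int) (m : 'I_n -> int),
          k != 0 /\ g *~ k - \sum_(i < n) e i *~ m i \in B}].

Definition value_transcendental (L : fieldType) (Gamma : oagType)
    (v : valuation L Gamma) (F E : {pred L}) : Prop :=
  dimQ_quotient_is (value_group v F) (value_group v E) 1.

Definition residue_transcendental (L : fieldType) (Gamma : oagType)
    (v : valuation L Gamma) (F E : {pred L}) : Prop :=
  trdeg_is (res_subfield v F) (res_subfield v E) 1.

Definition valuation_transcendental (L : fieldType) (Gamma : oagType)
    (v : valuation L Gamma) (F E : {pred L}) : Prop :=
  value_transcendental v F E \/ residue_transcendental v F E.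

(* nu_(a, gamma) at the polynomial \sum_i p`_i (x - a)^i *)
Definition monomial_value (L : fieldType) (Gamma : oagType)
    (v : valuation L Gamma) (gamma : Gamma) (p : {poly L}) : option Gamma :=
  \big[@minv Gamma/None]_(i < size p) addv (v p`_i) (Some (gamma *+ i)).

(* A valuation on Kbar(x) is determined by its values on Kbar[x], and every
   element of Kbar[x] is p.[x - a] for a unique p over Kbar. *)
Definition pair_of_definition (L : fieldType) (Gamma : oagType)
    (v : valuation L Gamma) (K : {pred L}) (x a : L) (gamma : Gamma) : Prop :=
  [/\ a \in algcl K,
      gamma \in value_group v (adjoin (algcl K) x)
    & forall p : {poly L}, p \is a polyOver (algcl K) ->
        v p.[x - a] = monomial_value v gamma p].

Definition minimal_pair_of_definition (L : fieldType) (Gamma : oagType)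
    (v : valuation L Gamma) (K : {pred L}) (x a : L) (gamma : Gamma) : Prop :=
  pair_of_definition v K x a gamma /\
  {in algcl K, forall b, lev (Some gamma) (v (a - b)) ->
     forall m n, degree_is K (adjoin K a) m -> degree_is K (adjoin K b) n ->
       (m <= n)%N}.

Definition inertia_field (L : fieldType) (Gamma : oagType)
    (v : valuation L Gamma) (K : {pred L}) : {pred L} :=
  [pred z in sepcl K | `[< forall s : L -> L,
     automorphism_over K (algcl K) s ->
     {in sepcl K, forall c, lev (Some 0) (v c) ->
        ltv (Some 0) (v (s c - c))} ->
     s z = z >]].

Definition ramification_field (L : fieldType) (Gamma : oagType)
    (v : valuation L Gamma) (K : {pred L}) : {pred L} :=
  [pred z in sepcl K | `[< forall s : L -> L,
     automorphism_over K (algcl K) s ->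
     {in sepcl K, forall c, c != 0 -> ltv (v c) (v (s c - c))} ->
     s z = z >]].

(* w1 and w2 have the same valuation ring in F. *)
Definition equivalent_on (L : fieldType) (Gamma1 Gamma2 : oagType)
    (F : {pred L}) (w1 : L -> option Gamma1) (w2 : L -> option Gamma2) : Prop :=
  {in F, forall z, lev (Some 0) (w1 z) = lev (Some 0) (w2 z)}.

(* The restriction of v to F has, up to equivalence, a unique extension to the
   algebraic closure of F. *)
Definition henselian (L : fieldType) (Gamma : oagType) (v : valuation L Gamma)
    (F : {pred L}) : Prop :=
  forall (Gamma' : oagType) (w : L -> option Gamma'),
    valuation_on (algcl F) w ->
    equivalent_on F w v -> equivalent_on (algcl F) w v.

(* The least henselian subfield of the algebraic closure of F containing F. *)
Definition henselization (L : fieldType) (Gamma : oagType)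
    (v : valuation L Gamma) (F : {pred L}) : {pred L} :=
  [pred z | `[< forall M : {pred L}, divring_closed M -> {subset F <= M} ->
     {subset M <= algcl F} -> henselian v M -> z \in M >]].

Definition implicit_constant_field (L : fieldType) (Gamma : oagType)
    (v : valuation L Gamma) (K : {pred L}) (x : L) : {pred L} :=
  [predI algcl K & henselization v (adjoin K x)].

(* Main.v *)
Require Import Defs.
From mathcomp Require Import all_boot all_order all_algebra.
From HB Require Import structures.
From mathcomp Require Import boolp separable closed_field zify.
From mathcomp Require classical_sets.

(* The key point is an extension principle for embeddings of valued fields.  An
   embedding that cannot be extended further inside an algebraic closure, among
   those matching the valuation rings (or among those preserving leading terms),
   is total: residues are adjoined through lifts of their minimal polynomials,
   values through roots of [X^q - d], and pseudo-limits through polynomials of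
   least degree (Kaplansky).  Over a maximal domain, every element thus has a best
   approximation, which can still be improved unless it is exact.  This gives the
   conjugacy of the extensions of a valuation without Hensel's lemma, and it
   describes the ramification group.

   Lower bound.  If [c = h(a)] with [h] over [K] and [deg h < [K(a) : K]], then
   minimality of [(a, gamma)] gives [v (h(x) - h(a)) > v (h(a))].  Hence an
   automorphism over a henselian [N] containing [K(x)] preserves the leading terms
   of all elements of [K(a)]; on [K(b)] it therefore agrees with an automorphism of
   Kbar preserving all leading terms, and fixes [b] if [b] lies in [K^r].  So [b]
   is in [N].  As [K^i] is contained in [K^r], this covers both cases.

   Upper bound.  Let [M] be henselian with [K(a) <= M <= Kbar].  Automorphisms of
   Kbar over [M] preserve [nu_(a, gamma)] on Kbar(x), so they extend to
   automorphisms [f] of Omega over [M(x)] preserving the valuation ring; the fixed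
   field of all such [f] is henselian.  Elements of Kbar fixed by [Aut(Kbar | M)]
   but outside [M] are avoided by a separably closed, hence henselian, field
   containing [M(x)]. *)

Set Implicit Arguments.
Unset Strict Implicit.
Unset Printing Implicit Defensive.

Import GRing.Theory.
Local Open Scope ring_scope.

(** * Valuations as divisibility relations *)

(* [vr y z] reads [v y <= v z]: a valuation is used only through this relation,
   so that valuations with different value groups can be compared. *)
Record valrel (L : fieldType) := ValRel {
  vr :> rel L;
  vr_total : total vr;
  vr_trans : transitive vr;
  vrD : forall y z t, vr y z -> vr y t -> vr y (z + t);
  vrM2l : forall c y z, c != 0 -> vr (c * y) (c * z) = vr y z;
  vr0l : forall y, vr 0 y -> y = 0
}.

Section ValRelTheory.
Context (L : fieldType) (v : valrel L).
Implicit Types y z t c : L.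

Definition vlt y z := ~~ v z y.

(* [y] and [z] have the same leading term: [v (y - z) > v y]. *)
Definition near y z := (y == z) || vlt y (y - z).

Lemma vr_refl y : v y y.
Proof. by have := vr_total v y y; rewrite orbb. Qed.
Hint Resolve vr_refl : core.

Lemma vr0 y : v y 0.
Proof. by have /orP[//|/[dup]/vr0l->] := vr_total v y 0. Qed.
Hint Resolve vr0 : core.

Lemma vlt_vr y z : vlt y z -> v y z.
Proof. by rewrite /vlt; case/orP: (vr_total v y z) => ->. Qed.

Lemma vlt_neq0 y z : vlt y z -> y != 0.
Proof. by apply: contraNneq => ->. Qed.

Lemma vlt0 y : y != 0 -> vlt y 0.
Proof. by move=> y0; apply: contra y0 => /vr0l->. Qed.

Lemma vltxx y : vlt y y = false.
Proof. by rewrite /vlt vr_refl. Qed.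

Lemma vr_vlt_trans y z t : v y z -> vlt z t -> vlt y t.
Proof. by move=> yz; apply: contra => ty; apply: vr_trans yz. Qed.

Lemma vlt_vr_trans y z t : vlt y z -> v z t -> vlt y t.
Proof. by move=> yz zt; apply: contra yz => ty; apply: vr_trans ty. Qed.

Lemma vlt_trans y z t : vlt y z -> vlt z t -> vlt y t.
Proof. by move=> yz /vlt_vr; apply: vlt_vr_trans. Qed.

Lemma vr1N1 : v 1 (-1).
Proof.
case/orP: (vr_total v 1 (-1)) => //.
by rewrite -(@vrM2l _ v (-1)) ?oppr_eq0 ?oner_eq0 // mulrNN !mulr1.
Qed.

Lemma vrN y z : v y (- z) = v y z.
Proof.
suff H t : v t (- t).
  apply/idP/idP => yz; apply: vr_trans yz _ => //.
  by rewrite -[z in v _ z]opprK.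
have [->|t0] := eqVneq t 0; first by rewrite oppr0.
by rewrite -[t in v t _]mulr1 -mulrN1 vrM2l ?vr1N1.
Qed.

Lemma vrNl y z : v (- y) z = v y z.
Proof.
apply/idP/idP; apply: vr_trans; first by rewrite vrN.
by rewrite -[y in v _ y]opprK vrN.
Qed.

Lemma vrB y z t : v y z -> v y t -> v y (z - t).
Proof. by move=> yz yt; rewrite vrD // vrN. Qed.

Lemma vltN y z : vlt y (- z) = vlt y z.
Proof. by rewrite /vlt vrNl. Qed.

Lemma vltD y z t : vlt y z -> vlt y t -> vlt y (z + t).
Proof.
move=> yz yt; apply/negP => zt.
case/orP: (vr_total v z t) => H.
  by move/negP: yz; apply; apply: vr_trans zt; rewrite vrD.
by move/negP: yt; apply; apply: vr_trans zt; rewrite vrD.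
Qed.

Lemma vltB y z t : vlt y z -> vlt y t -> vlt y (z - t).
Proof. by move=> yz yt; rewrite vltD // vltN. Qed.

Lemma vltM2l c y z : c != 0 -> vlt (c * y) (c * z) = vlt y z.
Proof. by move=> c0; rewrite /vlt vrM2l. Qed.

Lemma vrM2r c y z : c != 0 -> v (y * c) (z * c) = v y z.
Proof. by move=> c0; rewrite ![_ * c]mulrC vrM2l. Qed.

Lemma vrM y z y' z' : v y z -> v y' z' -> v (y * y') (z * z').
Proof.
move=> yz yz'; have [y0|y0] := eqVneq y 0.
  by move: yz; rewrite y0 => /vr0l->; rewrite !mul0r.
have [z0|z0] := eqVneq z' 0; first by rewrite z0 mulr0.
by apply: (@vr_trans _ _ (y * z')); rewrite ?vrM2l ?vrM2r.
Qed.

Lemma vltM y z y' z' : y' != 0 -> vlt y z -> v y' z' -> vlt (y * y') (z * z').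
Proof.
move=> y0 yz yz'; apply: (@vlt_vr_trans _ (z * y')); first by rewrite /vlt vrM2r.
exact: vrM.
Qed.

Lemma vr1M y z : v 1 y -> v 1 z -> v 1 (y * z).
Proof. by move=> y1 z1; rewrite -[1]mulr1 vrM. Qed.

Lemma vlt1Ml y z : vlt 1 y -> v 1 z -> vlt 1 (y * z).
Proof. by move=> y1 z1; rewrite -[1]mulr1 vltM ?oner_eq0. Qed.

Lemma vrX n y z : v y z -> v (y ^+ n) (z ^+ n).
Proof. by move=> yz; elim: n => // n IH; rewrite !exprS vrM. Qed.

Lemma vltX n y z : (0 < n)%N -> vlt y z -> vlt (y ^+ n) (z ^+ n).
Proof.
move=> n0 yz; case: n n0 => // n _; rewrite !exprS vltM ?vrX ?vlt_vr //.
by rewrite expf_neq0 // (vlt_neq0 yz).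
Qed.

Lemma vrXE n y z : (0 < n)%N -> v (y ^+ n) (z ^+ n) = v y z.
Proof.
by move=> n0; apply/idP/idP; [apply: contraLR; apply: vltX|apply: vrX].
Qed.

Lemma vr1_unit y z : v y 1 -> v 1 y -> v (y * z) z /\ v z (y * z).
Proof.
move=> y1 yy1; split; [rewrite -[z in v _ z]mul1r|rewrite -[z in v z _]mul1r].
  exact: vrM.
exact: vrM.
Qed.

Lemma near_refl y : near y y.
Proof. by rewrite /near eqxx. Qed.
Hint Resolve near_refl : core.

Lemma nearP y z : near y z -> v y z /\ v z y.
Proof.
case/orP => [/eqP->//|yz]; split; first by rewrite -[z](subKr y) vrB // vlt_vr.
by apply/negPn/negP => /(vltD yz); rewrite subrK vltxx.
Qed.

Lemma near_vr y z : near y z -> v y z.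
Proof. by case/nearP. Qed.

Lemma near_vr' y z : near y z -> v z y.
Proof. by case/nearP. Qed.

Lemma near_vlt y z : y != 0 -> near y z -> vlt y (y - z).
Proof. by move=> y0 /orP[/eqP<-|//]; rewrite subrr vlt0. Qed.

Lemma near_sym y z : near y z -> near z y.
Proof.
move=> yz; case/orP: (yz) => [/eqP->//|ltyz].
rewrite /near -opprB vltN orbC (@vr_vlt_trans _ y) //; exact: near_vr'.
Qed.

Lemma near_trans y z t : near y z -> near z t -> near y t.
Proof.
move=> yz zt; case/orP: (yz) => [/eqP->//|ltyz].
case/orP: (zt) => [/eqP<-//|ltzt].
rewrite /near -(subrKA z) orbC vltD //; apply: vr_vlt_trans ltzt; exact: near_vr.
Qed.

Lemma nearM2l c y z : near y z -> near (c * y) (c * z).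
Proof.
have [->|c0] := eqVneq c 0; first by rewrite !mul0r.
by case/orP => [/eqP->//|yz]; rewrite /near -mulrBr vltM2l // yz orbT.
Qed.

Lemma nearM y z y' z' : near y z -> near y' z' -> near (y * y') (z * z').
Proof.
move=> yz yz'; apply: (@near_trans _ (y * z')); first exact: nearM2l.
by rewrite ![_ * z']mulrC; apply: nearM2l.
Qed.

Lemma nearX n y z : near y z -> near (y ^+ n) (z ^+ n).
Proof. by move=> yz; elim: n => // n IH; rewrite !exprS nearM. Qed.

Lemma near_neq0 y z : y != 0 -> near y z -> z != 0.
Proof. by move=> y0 /near_vr'; apply: contraTneq => ->; apply: contraNN y0 => /vr0l->. Qed.

Lemma vlt_near y z : vlt y z -> near y (y + z).
Proof. by move=> yz; rewrite /near opprD addNKr vltN yz orbT. Qed.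

Lemma near_prod (I : Type) (r : seq I) (F G : I -> L) :
  (forall j, near (F j) (G j)) -> near (\prod_(j <- r) F j) (\prod_(j <- r) G j).
Proof.
by move=> H; apply: (big_ind2 (fun y z => near y z)) => // y z y' z'; apply: nearM.
Qed.

Lemma vr_sum (I : Type) (r : seq I) (P : pred I) (F : I -> L) y :
  (forall j, P j -> v y (F j)) -> v y (\sum_(j <- r | P j) F j).
Proof. by move=> H; apply: (big_ind (fun z => v y z)) => // z t; apply: vrD. Qed.

Lemma vlt_sum (I : Type) (r : seq I) (P : pred I) (F : I -> L) y : y != 0 ->
  (forall j, P j -> vlt y (F j)) -> vlt y (\sum_(j <- r | P j) F j).
Proof. by move=> y0 H; apply: (big_ind (vlt y)) => // [|z t]; [apply: vlt0|apply: vltD]. Qed.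

Lemma near_eqvr y z y' z' : near y z -> near y' z' -> v y y' = v z z'.
Proof.
move=> /nearP[yz zy] /nearP[yz' zy']; apply/idP/idP => H.
  by apply: (vr_trans zy); apply: (vr_trans H).
by apply: (vr_trans yz); apply: (vr_trans H).
Qed.

(** With no value group at hand, a least element is one with the fewest indices strictly below
    it. *)
Lemma vr_argmin (I : finType) (P : pred I) (F : I -> L) : (exists j, P j) ->
  exists2 j, P j & forall k, P k -> v (F j) (F k).
Proof.
case=> j0 Pj0.
case: (@arg_minnP I j0 P (fun j => #|[set k | P k && vlt (F k) (F j)]|) Pj0) => j Pj H.
exists j => // k Pk; apply/negPn/negP => kj.
have := H k Pk; rewrite leqNgt => /negP; apply; apply: proper_card.
apply/properP; split; first by apply/subsetP => l; rewrite !inE => /andP[-> /vlt_trans]; apply.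
by exists k; rewrite !inE Pk // vltxx.
Qed.
End ValRelTheory.
#[export] Hint Resolve vr_refl vr0 near_refl : core.

(** * Pseudo-limits *)

(* A family [A] indexed by a directed order without maximum, pseudo-Cauchy with
   respect to [v]; [plim z] says that [z] is one of its pseudo-limits. *)
Section PseudoLimits.
Context (L : closedFieldType) (v : valrel L) (T : Type) (t0 : T) (A : T -> L).
Context (prec : T -> T -> Prop).
Hypothesis prec_trans : forall a b c, prec a b -> prec b c -> prec a c.
Hypothesis prec_dir : forall a b, exists c, prec a c /\ prec b c.
Hypothesis prec_lt : forall a b c, prec a b -> prec b c ->
  vlt v (A b - A a) (A c - A b).

Definition plim z := forall a b, prec a b -> v (A b - A a) (z - A a).

Lemma plim_near z a b : plim z -> prec a b -> near v (A b - A a) (z - A a).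
Proof.
move=> lz ab; have [c [_ bc]] := prec_dir a b.
have -> : z - A a = (A b - A a) + (z - A b) by rewrite [RHS]addrC subrKA.
apply: vlt_near; apply: vlt_vr_trans (lz _ _ bc); exact: prec_lt bc.
Qed.

Lemma plim_lt z a b : plim z -> prec a b -> vlt v (z - A a) (z - A b).
Proof.
move=> lz ab; have [c [_ bc]] := prec_dir a b.
apply: vlt_vr_trans (near_vr (plim_near lz bc)).
apply: vr_vlt_trans (prec_lt ab bc); exact: near_vr' (plim_near lz ab).
Qed.

(** Some [A a] is closer to a later [A b] than to [z]. Beyond [b], and at every pseudo-limit, the
    difference with [z] keeps the leading term of [A a - z]. *)
Lemma nplim_near z : ~ plim z -> exists y a, [/\ y != 0,
  forall b, prec a b -> near v y (A b - z) & forall z', plim z' -> near v y (z' - z)].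
Proof.
move=> /existsNP[a] /existsNP[b] /not_implyP[ab /negP ltz].
have H c : near v (A b - A a) (c - A a) -> near v (A a - z) (c - z).
  move=> /near_vr abc; have -> : c - z = (A a - z) + (c - A a) by rewrite [RHS]addrC subrKA.
  apply: vlt_near; rewrite -opprB /vlt vrN; apply: vlt_vr_trans abc; exact: ltz.
exists (A a - z), b; split.
- by rewrite -oppr_eq0 opprB (vlt_neq0 ltz).
- move=> c bc; apply: H.
  have -> : A c - A a = (A b - A a) + (A c - A b) by rewrite [RHS]addrC subrKA.
  by apply: vlt_near; apply: prec_lt bc.
- by move=> z' lz'; apply: H; apply: plim_near ab.
Qed.

(** Over a closed field [p] splits into linear factors, and [nplim_near] applies to each. *)
Lemma nplim_poly (p : {poly L}) : p != 0 ->
  (forall z, root p z -> ~ plim z) -> exists y a, [/\ y != 0,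
    forall b, prec a b -> near v y p.[A b] & forall z, plim z -> near v y p.[z]].
Proof.
have [r ->] := closed_field_poly_normal p.
rewrite scaler_eq0 negb_or => /andP[lc0 _] nl.
suff [y [a [y0 H1 H2]]] : exists y a, [/\ y != 0,
    forall b, prec a b -> near v y (\prod_(z <- r) (A b - z))
  & forall z', plim z' -> near v y (\prod_(z <- r) (z' - z))].
  have E z : (lead_coef p *: \prod_(z <- r) ('X - z%:P)).[z]
      = lead_coef p * \prod_(z' <- r) (z - z').
    rewrite hornerZ horner_prod; congr (_ * _); apply: eq_bigr => z' _.
    by rewrite hornerXsubC.
  exists (lead_coef p * y), a; split; first by rewrite mulf_neq0.
    by move=> b ab; rewrite E nearM2l ?H1.
  by move=> z lz; rewrite E nearM2l ?H2.
have {}nl z : z \in r -> ~ plim z.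
  by move=> zr; apply: nl; rewrite rootZ // root_prod_XsubC.
elim: r nl => [|z r IH] nl.
  exists 1, t0; split; rewrite ?oner_eq0 // => *; rewrite big_nil //.
have [|y [a [y0 H1 H2]]] := IH; first by move=> t tr; apply: nl; rewrite inE tr orbT.
have [y' [a' [y'0 H1' H2']]] := nplim_near (nl z (mem_head _ _)).
have [c [ac a'c]] := prec_dir a a'.
exists (y' * y), c; split; first by rewrite mulf_neq0.
  move=> b cb; rewrite big_cons; apply: nearM; [apply: H1'|apply: H1]; exact: prec_trans cb.
by move=> z' lz'; rewrite big_cons; apply: nearM; auto.
Qed.

Lemma plim_lt_near z a b : plim z -> prec a b -> vlt v (A a - z) (A b - z).
Proof. by move=> lz ab; rewrite -!(opprB z) vltN /vlt vrN; apply: plim_lt. Qed.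

(** The factor at [z] strictly gains value along the family, while eventually no other factor loses
    any. *)
Lemma plim_poly (p : {poly L}) z : p != 0 -> root p z -> plim z ->
  exists a, forall b c, prec a b -> prec b c -> vlt v p.[A b] p.[A c].
Proof.
have [r ->] := closed_field_poly_normal p.
rewrite scaler_eq0 negb_or => /andP[lc0 _]; rewrite rootZ // root_prod_XsubC.
move=> zr lz; pose P s a := \prod_(z' <- s) (A a - z').
have E a : (lead_coef p *: \prod_(z <- r) ('X - z%:P)).[A a] = lead_coef p * P r a.
  rewrite hornerZ horner_prod; congr (_ * _); apply: eq_bigr => z' _.
  by rewrite hornerXsubC.
(* Both kinds of roots are covered: at a pseudo-limit the values increase, elsewhere they become
   constant. *)
have weak s : exists a, forall b c, prec a b -> prec b c ->
    v (P s b) (P s c) /\ P s b != 0.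
  elim: s => [|z' s [a H]].
    by exists t0 => b c _ _; rewrite /P !big_nil oner_eq0.
  have [a' H'] : exists a, forall b c, prec a b -> prec b c ->
      v (A b - z') (A c - z') /\ A b - z' != 0.
    have [lz'|nl] := pselect (plim z').
      exists t0 => b c _ bc; have lt := plim_lt_near lz' bc.
      by rewrite (vlt_neq0 lt) vlt_vr.
    have [y [a' [y0 H' _]]] := nplim_near nl.
    exists a' => b c ab bc; rewrite (near_neq0 y0 (H' _ ab)).
    split=> //; apply: vr_trans (near_vr (H' _ (prec_trans ab bc))).
    exact: near_vr' (H' _ ab).
  have [d [ad a'd]] := prec_dir a a'; exists d => b c db bc.
  have [H1 H2] := H _ _ (prec_trans ad db) bc.
  have [H1' H2'] := H' _ _ (prec_trans a'd db) bc.
  by rewrite /P !big_cons mulf_neq0 // vrM.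
(* Only one occurrence of [z] is removed; further ones are among the factors handled by [weak]. *)
have [a H] := weak (rem z r); exists a => b c ab bc.
rewrite !E vltM2l // /P !(big_rem z zr) /=.
have [H1 H2] := H _ _ ab bc.
by apply: vltM => //; apply: plim_lt_near.
Qed.
End PseudoLimits.

(** * Residues and values of polynomials *)

Section IntegralPoly.
Context (L : closedFieldType) (u : valrel L).
Implicit Types (P Q : {poly L}) (y z : L).

Lemma horner_integral P y : (forall k, u 1 P`_k) -> u 1 y -> u 1 P.[y].
Proof.
move=> P1 y1; rewrite horner_coef; apply: vr_sum => k _.
by apply: vr1M => //; rewrite -[1](expr1n L k) vrX.
Qed.

Lemma horner_small P y : (forall k, vlt u 1 P`_k) -> u 1 y -> vlt u 1 P.[y].
Proof.
move=> P1 y1; rewrite horner_coef; apply: vlt_sum => [|k _]; first exact: oner_neq0.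
by apply: vlt1Ml => //; rewrite -[1](expr1n L k) vrX.
Qed.

Lemma horner_cont P y z : (forall k, u 1 P`_k) -> u 1 y -> u 1 z ->
  vlt u 1 (y - z) -> vlt u 1 (P.[y] - P.[z]).
Proof.
move=> P1 y1 z1 yz; rewrite !horner_coef -sumrB; apply: vlt_sum => [|k _].
  exact: oner_neq0.
rewrite -mulrBr subrXX mulrCA; apply: vlt1Ml => //; apply: vr1M => //.
apply: vr_sum => m _; apply: vr1M.
  by rewrite -[1](expr1n L (k.-1 - m)) vrX.
by rewrite -[1](expr1n L m) vrX.
Qed.

(** If [y - z] had value at most 0 for every root [z], so would the product [P.[y]]. This replaces
    Hensel's lemma: the root is merely found in [L]. *)
Lemma root_small P y : P != 0 -> u (lead_coef P) 1 -> vlt u 1 P.[y] ->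
  exists2 z, root P z & vlt u 1 (y - z).
Proof.
move=> P0 lc1; have [r DP] := closed_field_poly_normal P.
rewrite {1}DP hornerZ horner_prod => sm; apply: contrapT => H.
move: sm; rewrite /vlt -[X in u _ X]mulr1 vrM //.
rewrite big_seq; apply: (big_ind (fun t => u t 1)) => [|t t' t1 t1'|z zr] //.
  by rewrite -[1]mulr1 vrM.
rewrite hornerXsubC; apply/negPn/negP => yz; apply: H; exists z => //.
by rewrite DP rootZ ?lead_coef_eq0 // root_prod_XsubC.
Qed.

(** If [y] had negative value, the leading monomial alone would determine the value of [P.[y]]. *)
Lemma root_integral P y : P != 0 -> (forall k, u 1 P`_k) -> u (lead_coef P) 1 ->
  root P y -> u 1 y.
Proof.
move=> P0 P1 lc1 /rootP Py; apply/negPn/negP => y1.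
have y0 : y != 0 by rewrite (vlt_neq0 y1).
have lc0 : lead_coef P != 0 by rewrite lead_coef_eq0.
have [n sP] : exists n, size P = n.+1.
  by move: P0; rewrite -size_poly_gt0; case: size => // n _; exists n.
have: near u (lead_coef P * y ^+ n) P.[y].
  rewrite horner_coef sP big_ord_recr /= [X in near _ _ X]addrC.
  rewrite -[n in P`_n]/n.+1.-1 -sP -lead_coefE; apply: vlt_near.
  apply: vlt_sum => [|k _]; first by rewrite mulf_neq0 // expf_neq0.
  apply: (@vr_vlt_trans _ _ _ (y ^+ n)).
    by rewrite -[X in u _ X]mul1r vrM.
   apply: (@vlt_vr_trans _ _ _ (y ^+ k)); last first.
    by rewrite -[X in u X _]mul1r vrM.
  have -> : y ^+ n = y ^+ k * y ^+ (n - k) by rewrite -exprD subnKC // ltnW.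
  rewrite -[X in vlt _ _ X]mulr1 vltM2l ?expf_neq0 //.
  by rewrite -[1](expr1n L (n - k)) vltX // subn_gt0.
rewrite Py => /near_vr' /vr0l /eqP.
by rewrite mulf_eq0 expf_eq0 (negPf y0) (negPf lc0) andbF.
Qed.
End IntegralPoly.

Section ResiduePoly.
Context (L : closedFieldType) (F : fieldType) (u : valrel L) (j : {rmorphism F -> L}).
Implicit Types (p q h r : {poly F}) (y z : L).

Definition integral p := forall k, u 1 (j p`_k).
(** Gauss value 0: the reduction of [p] to the residue field is a nonzero polynomial. *)
Definition unimod p := integral p /\ exists k, u (j p`_k) 1.

Lemma integral_map p k : integral p -> u 1 (map_poly j p)`_k.
Proof. by move=> ip; rewrite coef_map; apply: ip. Qed.

Lemma unimod_neq0 p : unimod p -> p != 0.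
Proof.
by case=> _ [k]; apply: contraTneq => ->; rewrite coef0 rmorph0; apply: vlt0; apply: oner_neq0.
Qed.

Lemma lead_unimod p : integral p -> u (j (lead_coef p)) 1 -> unimod p.
Proof. by move=> ip lp; split=> //; exists (size p).-1; rewrite -lead_coefE. Qed.

Lemma unimod_scale p : p != 0 -> exists c q, [/\ c != 0, p = c *: q,
  size q = size p & unimod q].
Proof.
rewrite -size_poly_gt0 => sp.
have [|k _ kmin] := @vr_argmin _ u _ predT (fun k : 'I_(size p) => j p`_k).
  by exists (Ordinal sp).
have lead0 : lead_coef p != 0 by rewrite lead_coef_eq0 -size_poly_gt0.
have c0 : p`_k != 0.
  have sp' : ((size p).-1 < size p)%N by rewrite prednK.
  have := kmin (Ordinal sp') isT; rewrite /= -lead_coefE.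
  apply: contraTneq => ->; rewrite rmorph0; apply/negP => /vr0l /eqP.
  by rewrite fmorph_eq0 (negPf lead0).
exists p`_k, ((p`_k)^-1 *: p); split=> //.
- by rewrite scalerA divff // scale1r.
- by rewrite size_scale // invr_eq0.
split=> [m|]; last by exists k; rewrite coefZ mulVf // rmorph1.
rewrite coefZ rmorphM fmorphV -(@vrM2l _ _ (j p`_k)) ?fmorph_eq0 //.
rewrite mulr1 mulrA divff ?fmorph_eq0 // mul1r.
have [sm|ms] := leqP (size p) m; last exact: kmin (Ordinal ms) isT.
by rewrite (nth_default _ sm) rmorph0.
Qed.

(** Long division: as the leading coefficient of [h] is a unit, each cancelling monomial has an
    integral coefficient. *)
Lemma integral_div p h : integral p -> integral h -> u (j (lead_coef h)) 1 ->
  exists q r, [/\ integral q, integral r, p = q * h + r & (size r < size h)%N].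
Proof.
move=> ip ih lh; have h0 := unimod_neq0 (lead_unimod ih lh).
have lh0 : lead_coef h != 0 by rewrite lead_coef_eq0.
have [n] := ubnP (size p); elim: n p ip => // n IH p ip /ltnSE sn.
have i0 : integral 0 by move=> k; rewrite coef0 rmorph0.
have [sp|hp] := ltnP (size p) (size h).
  by exists 0, p; split=> //; rewrite mul0r add0r.
pose k := (size p - size h)%N; pose c := lead_coef p / lead_coef h.
have ic : u 1 (j c).
  rewrite fmorph_div -(@vrM2l _ _ (j (lead_coef h))) ?fmorph_eq0 //.
  rewrite mulr1 mulrC divfK ?fmorph_eq0 //; apply: vr_trans lh _; exact: ip.
pose m := c *: 'X^k; have im : integral m.
  by move=> l; rewrite coefZ coefXn; case: eqP; rewrite ?mulr1 ?mulr0 ?rmorph0.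
have [||q [r [iq ir Ep sr]]] := IH (p - m * h).
- move=> l; rewrite coefB /m -scalerAl coefZ coefXnM rmorphB rmorphM vrB //.
  by apply: vr1M => //; case: ifP => _; rewrite ?rmorph0.
- apply: leq_trans sn; have sp0 : (0 < size p)%N.
    by apply: leq_trans hp; rewrite size_poly_gt0.
  rewrite -[X in (_ < X)%N](prednK sp0) ltnS; apply/leq_sizeP => l.
  have sE : ((size p).-1 - k = (size h).-1)%N.
    by rewrite /k; move: hp sp0; rewrite -size_poly_gt0 in h0; lia.
  have kl : (k <= (size p).-1)%N by rewrite -size_poly_gt0 in h0; rewrite /k; lia.
  rewrite leq_eqVlt => /orP[/eqP<-|pl]; rewrite coefB /m -scalerAl coefZ coefXnM.
    by rewrite ltnNge kl /= sE -!lead_coefE divfK // subrr.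
  have lp : (size p <= l)%N by rewrite -(prednK sp0).
  have hk : (size h <= l - k)%N by rewrite /k; lia.
  by rewrite (nth_default _ lp) (nth_default _ hk); case: ifP; rewrite mulr0 subr0.
exists (q + m), r; split=> //.
- by move=> l; rewrite coefD rmorphD vrD.
- by rewrite mulrDl addrAC -Ep subrK.
Qed.

Context (y : L) (y1 : u 1 y).

(** The reduction of [p] is nonzero and has the residue of [y] as a root. *)
Definition resroot p := unimod p /\ vlt u 1 (map_poly j p).[y].

(** If the leading coefficient had residue 0, dropping the leading term would give a smaller
    polynomial with the same reduction. *)
Lemma resroot_lead p : resroot p ->
  (forall h, resroot h -> (size p <= size h)%N) -> u (j (lead_coef p)) 1.
Proof.
move=> [up rp] minp; apply/negPn/negP => lp.
have p0 := unimod_neq0 up; have sp : (0 < size p)%N by rewrite size_poly_gt0.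
pose h := take_poly (size p).-1 p.
have Eh : p = h + lead_coef p *: 'X^((size p).-1).
  apply/polyP => k; rewrite coefD coef_take_poly coefZ coefXn.
  case: ltngtP => [||->]; rewrite ?mulr0 ?addr0 // ?add0r ?mulr1 //.
  by move=> k_gt; rewrite nth_default // -(prednK sp).
have : (size p <= size h)%N.
  apply: minp; split.
    split=> [k|]; first by rewrite coef_take_poly; case: ifP => _; rewrite ?rmorph0 ?up.1.
    have [k uk] := up.2; exists k; rewrite coef_take_poly.
    have [_|kp] := ltnP k (size p).-1; first exact: uk.
    suff: u (j (lead_coef p)) 1 by rewrite (negPf lp).
    move: kp; rewrite leq_eqVlt => /orP[/eqP kE|kp]; first by rewrite lead_coefE kE.
    have pk0 : p`_k = 0 by rewrite nth_default // -(prednK sp).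
    by move: uk; rewrite pk0 rmorph0 => /vr0l/eqP; rewrite oner_eq0.
  have -> : h = p - lead_coef p *: 'X^((size p).-1) by rewrite {1}Eh addrK.
  rewrite rmorphB /= hornerD hornerN vltB // map_polyZ hornerZ map_polyXn hornerXn.
  by apply: vlt1Ml => //; rewrite -[1](expr1n L (size p).-1) vrX.
rewrite leqNgt => /negP; apply; apply: leq_ltn_trans (size_take_poly _ _) _.
by rewrite prednK.
Qed.
End ResiduePoly.

Section Dominant.
Context (L : closedFieldType) (F : fieldType) (u : valrel L) (j : {rmorphism F -> L}).
Implicit Types (h : {poly F}) (r : L).

Definition dominant h r k := h`_k != 0 /\
  forall m, m != k -> vlt u (j h`_k * r ^+ k) (j h`_m * r ^+ m).

Lemma dominant_near h r k : r != 0 -> dominant h r k ->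
  near u (j h`_k * r ^+ k) (map_poly j h).[r].
Proof.
move=> r0 [hk H]; have kh : (k < size h)%N.
  by rewrite ltnNge; apply: contra hk => /(nth_default 0)->.
rewrite horner_coef size_map_poly (bigD1 (Ordinal kh)) //= coef_map.
apply: vlt_near; apply: vlt_sum => [|m mk].
  by rewrite mulf_neq0 ?fmorph_eq0 // expf_neq0.
by rewrite coef_map; apply: H.
Qed.

(** Two monomials of equal value would give some [r ^+ k] with [0 < k < size h] the value of a
    nonzero element of [F]; so the least value is reached only once. *)
Lemma exists_dominant h r : h != 0 -> r != 0 ->
  (forall k d, (0 < k < size h)%N -> d != 0 -> ~ (u (j d) (r ^+ k) /\ u (r ^+ k) (j d))) ->
  exists k, dominant h r k.
Proof.
rewrite -size_poly_gt0 => h0 r0 H.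
have [|k _ kmin] := @vr_argmin _ u _ predT (fun k : 'I_(size h) => j h`_k * r ^+ k).
  by exists (Ordinal h0).
have hk : h`_k != 0.
  have sp' : ((size h).-1 < size h)%N by rewrite prednK.
  have := kmin (Ordinal sp') isT; rewrite /= -lead_coefE.
  apply: contraTneq => ->; rewrite rmorph0 mul0r; apply/negP => /vr0l /eqP.
  rewrite mulf_eq0 fmorph_eq0 expf_eq0 (negPf r0) andbF orbF lead_coef_eq0.
  by move=> /eqP hE; move: h0; rewrite hE size_poly0.
have key m n : (m < n)%N -> (n < size h)%N -> h`_m != 0 -> h`_n != 0 ->
    u (j h`_m * r ^+ m) (j h`_n * r ^+ n) -> u (j h`_n * r ^+ n) (j h`_m * r ^+ m) -> False.
  move=> mn nh hm hn; have rm0 : r ^+ m != 0 by rewrite expf_neq0.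
  have -> : r ^+ n = r ^+ (n - m) * r ^+ m by rewrite -exprD subnK // ltnW.
  rewrite mulrA !vrM2r // => H1 H2.
  apply: (H (n - m)%N (h`_m / h`_n)).
  - by rewrite subn_gt0 mn (leq_ltn_trans (leq_subr _ _) nh).
  - by rewrite mulf_neq0 // invr_eq0.
  have jn0 : j h`_n != 0 by rewrite fmorph_eq0.
  by rewrite fmorph_div; split; rewrite -(vrM2l u _ _ jn0) [_ * (_ / _)]mulrC divfK.
exists k; split=> // m mk; rewrite /vlt; apply/negP => le.
have [mh|] := ltnP m (size h); last first.
  move=> hm; move: le; rewrite (nth_default _ hm) rmorph0 mul0r => /vr0l /eqP.
  by rewrite mulf_eq0 fmorph_eq0 expf_eq0 (negPf r0) andbF orbF (negPf hk).
have hm : h`_m != 0.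
  apply: contraTneq le => ->; rewrite rmorph0 mul0r; apply: vlt0.
  by rewrite mulf_neq0 ?fmorph_eq0 // expf_neq0.
have ge := kmin (Ordinal mh) isT.
by move: mk; rewrite neq_ltn => /orP[] mk; [apply: (key m k)|apply: (key k m)].
Qed.

(** [root_small] at 1 for [X^q - e / r^q] gives a root near 1, which is then multiplied by [r]. *)
Lemma root_near (r e : L) q : (0 < q)%N -> r != 0 -> near u (r ^+ q) e ->
  exists2 z, z ^+ q = e & near u r z.
Proof.
move=> q0 r0 re; have rq0 : r ^+ q != 0 by rewrite expf_neq0.
pose P : {poly L} := 'X^q - (e / r ^+ q)%:P.
have [|||z] := @root_small _ u P 1.
- by rewrite -size_poly_gt0 size_XnsubC.
- by rewrite lead_coefXnsubC ?vr_refl.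
- rewrite !hornerE expr1n -(vltM2l u _ _ rq0) mulr1 mulrBr mulr1 mulrC divfK //.
  exact: near_vlt.
rewrite rootE !hornerE subr_eq0 => /eqP zq z1; exists (r * z).
  by rewrite exprMn zq mulrC divfK.
by rewrite /near -[r in vlt u r _]mulr1 -[X in X - _]mulr1 -mulrBr vltM2l // z1 orbT.
Qed.
End Dominant.

(** * Maximal embeddings are total *)

Section MaximalEmbedding.
Context (L : closedFieldType) (w v : valrel L) (lead : bool).
Hypothesis lead_eq : lead -> w = v.

(* Without [lead], an embedding only has to match the valuation rings of [w] and
   [v]; with [lead], where [w = v], it also has to preserve leading terms. *)
Definition compat c c' := w 1 c = v 1 c' /\ (lead -> near v c c').

Lemma compat_near c c' d d' : compat c c' -> near w c d -> near v c' d' ->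
  compat d d'.
Proof.
move=> [e n] cd cd'; split.
  rewrite -(near_eqvr (near_refl _ _) cd) -(near_eqvr (near_refl _ _) cd').
  exact: e.
move=> l; apply: near_trans cd'; apply: near_trans (n l).
by rewrite -(lead_eq l); apply: near_sym.
Qed.

Context (F : fieldType) (i s : {rmorphism F -> L}).
Hypothesis compat_is : forall c, compat (i c) (s c).
(** The condition on [h] makes [p] a polynomial of least degree vanishing at [y], and says that
    sending [y] to [y'] extends the embedding compatibly; a maximal embedding already has such a [y]
    in its domain. *)
Hypothesis maximal_is : forall (p : {poly F}) y y', p != 0 ->
  root (map_poly i p) y -> root (map_poly s p) y' ->
  (forall h : {poly F}, h != 0 -> (size h < size p)%N ->
     (map_poly i h).[y] != 0 /\ compat (map_poly i h).[y] (map_poly s h).[y']) ->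
  exists c, i c = y.
Hypothesis alg_i : forall y, algebraicOver i y.

Lemma vr_is c d : w (i c) (i d) = v (s c) (s d).
Proof.
have [->|c0] := eqVneq c 0.
  have [->|d0] := eqVneq d 0; first by rewrite !rmorph0 !vr_refl.
  rewrite !rmorph0; have H (u : valrel L) (j : {rmorphism F -> L}) : u 0 (j d) = false.
    by apply/negP => /vr0l/eqP; rewrite fmorph_eq0 (negPf d0).
  by rewrite !H.
have [e _] := compat_is (d / c); move: e; rewrite !fmorph_div.
rewrite -(vrM2l w _ _ (_ : i c != 0)) ?fmorph_eq0 // mulr1 mulrC divfK ?fmorph_eq0 //.
move=> ->; rewrite -(vrM2l v _ _ (_ : s c != 0)) ?fmorph_eq0 // mulr1 mulrC.
by rewrite divfK ?fmorph_eq0.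
Qed.

Lemma vlt_is c d : vlt w (i c) (i d) = vlt v (s c) (s d).
Proof. by rewrite /vlt vr_is. Qed.

(* Kaplansky: otherwise a polynomial of least degree with a pseudo-limit of the
   [i a] among its roots provides an extension of [s] to a larger field. *)
Lemma best_approx y : exists a, forall b, ~~ vlt w (y - i a) (y - i b).
Proof.
apply: contrapT => nomax'.
have nomax a : exists b, vlt w (y - i a) (y - i b).
  apply: contrapT => H; apply: nomax'; exists a => b; apply/negP => H'.
  by apply: H; exists b.
(* The family is indexed by [F] itself, ordered by closeness to [y]; the absence of a maximum makes
   this order directed. *)
pose prec a b : Prop := vlt w (y - i a) (y - i b).
have prec_trans a b c : prec a b -> prec b c -> prec a c by apply: vlt_trans.
have prec_dir a b : exists c, prec a c /\ prec b c.
  have [c ac] := nomax a; have [d bd] := nomax b.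
  case/orP: (vr_total w (y - i a) (y - i b)) => H.
    by exists d; split=> //; apply: vr_vlt_trans H bd.
  by exists c; split=> //; apply: vr_vlt_trans H ac.
have precE a b : prec a b -> near w (y - i a) (i b - i a).
  move=> ab; have -> : i b - i a = (y - i a) + - (y - i b).
    by rewrite opprB [RHS]addrC subrKA.
  by apply: vlt_near; rewrite vltN.
have prec_lti a b c : prec a b -> prec b c -> vlt w (i b - i a) (i c - i b).
  move=> ab bc; apply: vlt_vr_trans (near_vr (precE _ _ bc)).
  by apply: (vr_vlt_trans _ ab); apply: near_vr' (precE _ _ ab).
have prec_lts a b c : prec a b -> prec b c -> vlt v (s b - s a) (s c - s b).
  by rewrite -!rmorphB -vlt_is !rmorphB; apply: prec_lti.
pose limi := plim w i prec; pose lims := plim v s prec.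
have limy : limi y by move=> a b ab; apply: near_vr' (precE _ _ ab).
have Ei h a : (map_poly i h).[i a] = i h.[a] by rewrite horner_map.
have Es h a : (map_poly s h).[s a] = s h.[a] by rewrite horner_map.
(* Whether a pseudo-limit is among the roots of [h] can be read off from the values of [h] on [F],
   which end up strictly increasing or constant; [i] and [s] match these values. *)
have lim_is (h : {poly F}) : h != 0 -> ((exists2 z, root (map_poly i h) z & limi z) <->
                           (exists2 z, root (map_poly s h) z & lims z)).
  move=> h0; split => -[z rz lz]; apply: contrapT => nl.
    have [|a H] := plim_poly 0 prec_trans prec_dir prec_lti _ rz lz; first by rewrite map_poly_eq0.
    have [||y' [a' [y'0 H' _]]] := @nplim_poly _ v _ 0 s prec prec_trans prec_dir prec_lts (map_poly s h).
    - by rewrite map_poly_eq0.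
    - by move=> z' rz' lz'; apply: nl; exists z'.
    have [b [ab a'b]] := prec_dir a a'; have [c bc] := nomax b.
    have := H _ _ ab bc; rewrite !Ei vlt_is -!Es.
    rewrite /vlt; have := near_vr' (H' _ (prec_trans _ _ _ a'b bc)).
    by move=> /vr_trans -> //; apply: near_vr (H' _ a'b).
  have [|a H] := plim_poly 0 prec_trans prec_dir prec_lts _ rz lz; first by rewrite map_poly_eq0.
  have [||y' [a' [y'0 H' _]]] := @nplim_poly _ w _ 0 i prec prec_trans prec_dir prec_lti (map_poly i h).
  - by rewrite map_poly_eq0.
  - by move=> z' rz' lz'; apply: nl; exists z'.
  have [b [ab a'b]] := prec_dir a a'; have [c bc] := nomax b.
  have := H _ _ ab bc; rewrite !Es -vlt_is -!Ei.
  rewrite /vlt; have := near_vr' (H' _ (prec_trans _ _ _ a'b bc)).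
  by move=> /vr_trans -> //; apply: near_vr (H' _ a'b).
pose Q n := `[<exists p : {poly F}, [/\ p != 0, size p = n &
  exists2 z, root (map_poly i p) z & limi z]>].
have exQ : exists n, Q n.
  have [p p0 rp] := alg_i y; exists (size p); apply/asboolP; exists p; split=> //.
  by exists y.
case: (ex_minnP exQ) => n /asboolP[p [p0 sp [z rz lz]]] minp.
have nl (h : {poly F}) : h != 0 -> (size h < size p)%N ->
    ~ (exists2 z, root (map_poly i h) z & limi z).
  move=> h0 sh lh; have : Q (size h) by apply/asboolP; exists h.
  by move=> /minp; rewrite -sp leqNgt sh.
have [z' rz' lz'] : exists2 z, root (map_poly s p) z & lims z.
  by apply/(lim_is _ p0); exists z.
have [c cz] : exists c, i c = z.
  (* No root of [h] is a pseudo-limit, so at [z] and [z'] it has the leading terms of the two images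
     of [h.[d]], for [d] far enough. *)
  apply: (maximal_is p0 rz rz') => h h0 sh.
  have nli := nl _ h0 sh; have nls : ~ (exists2 z, root (map_poly s h) z & lims z).
    by move/(lim_is _ h0).
  have [||u [b [u0 H1 H2]]] := @nplim_poly _ w _ 0 i prec prec_trans prec_dir prec_lti (map_poly i h).
  - by rewrite map_poly_eq0.
  - by move=> t rt lt; apply: nli; exists t.
  have [||u' [b' [u'0 H1' H2']]] := @nplim_poly _ v _ 0 s prec prec_trans prec_dir prec_lts (map_poly s h).
  - by rewrite map_poly_eq0.
  - by move=> t rt lt; apply: nls; exists t.
  split; first exact: near_neq0 u0 (H2 _ lz).
  have [d [bd b'd]] := prec_dir b b'.
  apply: (@compat_near (i h.[d]) (s h.[d])) => //.
    by rewrite -Ei; apply: near_trans (near_sym (H1 _ bd)) (H2 _ lz).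
  by rewrite -Es; apply: near_trans (near_sym (H1' _ b'd)) (H2' _ lz').
(* The pseudo-limit [z = i c] would be strictly closer to some [i d] than to itself. *)
have [d cd] := nomax c; have := plim_lt prec_dir prec_lti lz cd.
by rewrite cz subrr => /vlt_neq0; rewrite eqxx.
Qed.

Lemma vr1_is c : w 1 (i c) = v 1 (s c).
Proof. by have := vr_is 1 c; rewrite !rmorph1. Qed.

Lemma vr_is1 c : w (i c) 1 = v (s c) 1.
Proof. by have := vr_is c 1; rewrite !rmorph1. Qed.

Lemma unimod_is p : unimod w i p <-> unimod v s p.
Proof.
split=> -[ip [k uk]]; split.
- by move=> m; rewrite -vr1_is.
- by exists k; rewrite -vr_is1.
- by move=> m; rewrite vr1_is.
- by exists k; rewrite vr_is1.
Qed.

Lemma compat_unit c y y' : w 1 y -> w y 1 -> v 1 y' -> v y' 1 ->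
  (lead -> near v y y') -> compat (i c * y) (s c * y').
Proof.
move=> y1 yy1 y'1 yy'1 n; have [e l] := compat_is c; split; last first.
  by move=> h; apply: nearM; [apply: l|apply: n].
have [w1 w2] := vr1_unit (i c) yy1 y1; have [v1 v2] := vr1_unit (s c) yy'1 y'1.
rewrite ![_ * y]mulrC ![_ * y']mulrC.
have -> : w 1 (y * i c) = w 1 (i c).
  by apply/idP/idP => h; [apply: vr_trans h w1|apply: vr_trans h w2].
by rewrite e; apply/idP/idP => h; [apply: vr_trans h v2|apply: vr_trans h v1].
Qed.

(** Since leading terms are preserved, [i] and [s] agree modulo the maximal ideal on the
    coefficients of [h]. *)
Lemma horner_is h y : lead -> unimod w i h -> w 1 y ->
  vlt v 1 ((map_poly s h).[y] - (map_poly i h).[y]).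
Proof.
move=> l uh y1; have wv := lead_eq l.
rewrite -hornerN -hornerD; apply: horner_small; last by rewrite -wv.
move=> k; rewrite coefB !coef_map /=; have [_ /(_ l)/near_sym n] := compat_is h`_k.
have [h0|h0] := eqVneq h`_k 0; first by rewrite h0 !rmorph0 subr0 vlt0 ?oner_eq0.
apply: vr_vlt_trans (near_vlt _ n); last by rewrite fmorph_eq0.
by rewrite -vr1_is; apply: uh.1.
Qed.

(* [p] lifts a minimal polynomial of the residue of [y], and [z], [z'] lift a root
   of that residual polynomial and of its image. *)
Lemma residue_root y : w 1 y -> w y 1 -> exists (p : {poly F}) z z', [/\ p != 0,
    [/\ root (map_poly i p) z, w 1 z & vlt w 1 (y - z)],
    [/\ root (map_poly s p) z', v 1 z' & lead -> vlt v 1 (y - z')]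
  & forall h, unimod w i h -> (size h < size p)%N ->
      w (map_poly i h).[z] 1 /\ v (map_poly s h).[z'] 1].
Proof.
move=> y1 yy1.
pose Q n := `[<exists p : {poly F}, size p = n /\ resroot w i y p>].
have exQ : exists n, Q n.
  have [p p0 /rootP rp] := alg_i y; have [c [q [c0 Ep sq uq]]] := unimod_scale w i p0.
  exists (size q); apply/asboolP; exists q; split=> //; split=> //.
  move: rp; rewrite Ep map_polyZ hornerZ => /eqP; rewrite mulf_eq0 fmorph_eq0 (negPf c0).
  by move=> /eqP->; apply: vlt0; apply: oner_neq0.
case: (ex_minnP exQ) => n /asboolP[p [sp rp]] minQ.
have minp h : resroot w i y h -> (size p <= size h)%N.
  by move=> rh; rewrite sp; apply: minQ; apply/asboolP; exists h.
have lp := resroot_lead y1 rp minp; have [[ip _] sm] := rp.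
have p0 := unimod_neq0 rp.1.
have small h : unimod w i h -> (size h < size p)%N -> w (map_poly i h).[y] 1.
  move=> uh; rewrite ltnNge; apply: contraNT => rh; exact: minp.
have [||z rz yz] := root_small _ _ sm; rewrite ?map_poly_eq0 ?lead_coef_map //.
have z1 : w 1 z by rewrite -(subKr y z) vrB // vlt_vr.
have ei h : unimod w i h -> vlt w 1 ((map_poly i h).[z] - (map_poly i h).[y]).
  move=> uh; apply: horner_cont => // [k|]; first exact: integral_map uh.1.
  by rewrite -opprB vltN.
have uw h : unimod w i h -> (size h < size p)%N -> w (map_poly i h).[z] 1.
  move=> uh sh; apply/negPn/negP => hz; have := small _ uh sh.
  by rewrite -(subKr (map_poly i h).[z] (map_poly i h).[y]); apply/negP; apply: vltB => //; apply: ei.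
have lps : v (s (lead_coef p)) 1 by rewrite -vr_is1.
have ps : forall k, v 1 (map_poly s p)`_k.
  by move=> k; rewrite coef_map -vr1_is; apply: ip.
suff [z' [rz' z'1 near' uv]] : exists z', [/\ root (map_poly s p) z', v 1 z',
    lead -> vlt v 1 (y - z') & forall h, unimod w i h -> (size h < size p)%N ->
      v (map_poly s h).[z'] 1].
  exists p, z, z'; split=> // h uh sh; split; [exact: uw|exact: uv].
(* With [lead], the two images of [p] have the same reduction, so [z'] can be found near [y] as well
   and inherits [small]. *)
have [l|nl] := boolP lead.
  have wv := lead_eq l.
  have si h : unimod w i h -> vlt v 1 ((map_poly s h).[y] - (map_poly i h).[y]).
    by move=> uh; apply: horner_is.
  have [|||z' rz' yz'] := @root_small _ v (map_poly s p) y.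
  - by rewrite map_poly_eq0.
  - by rewrite lead_coef_map.
  - rewrite -(subrK (map_poly i p).[y] (map_poly s p).[y]) vltD ?si -?wv //.
    exact: rp.1.
  have z'1 : v 1 z' by rewrite -(subKr y z') vrB -?wv // wv vlt_vr.
  exists z'; split=> // h uh sh; apply/negPn/negP => hz.
  have := small _ uh sh; rewrite wv; apply/negP.
  rewrite -(subKr (map_poly s h).[z'] (map_poly i h).[y]); apply: vltB => //.
  rewrite -(subrKA (map_poly s h).[y]) vltD //; last exact: si.
  apply: horner_cont => // [k||]; rewrite -?wv //; last by rewrite wv -opprB vltN.
  by rewrite coef_map wv; apply: ((unimod_is h).1 uh).1.
(* Without [lead], any root [z'] of the image of [p] is taken; it remains to see that this image
   still reduces to a minimal polynomial. *)
have sp1 : size (map_poly s p) != 1%N.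
  apply/negP; rewrite size_map_poly => /size_poly1P[c c0 Ep].
  move: sm lp; rewrite Ep map_polyC hornerC lead_coefC /vlt.
  by move=> /negP.
have [z' rz'] := closed_rootP _ sp1.
have z'1 : v 1 z'.
  by apply: root_integral rz'; rewrite ?map_poly_eq0 // lead_coef_map.
exists z'; split=> //.
apply: contrapT => /existsNP[h0] /not_implyP[uh0 /not_implyP[sh0 /negP hz0]].
pose Q' n := `[<exists h : {poly F}, size h = n /\ resroot v s z' h>].
have exQ' : exists n, Q' n.
  exists (size h0); apply/asboolP; exists h0; split=> //; split=> //.
  exact/unimod_is.
case: (ex_minnP exQ') => n' /asboolP[h [sh rh]] minQ'.
have minh g : resroot v s z' g -> (size h <= size g)%N.
  by move=> rg; rewrite sh; apply: minQ'; apply/asboolP; exists g.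
have lh := resroot_lead z'1 rh minh; have [uh smh] := rh.
have [ih _] := uh; have uwh := (unimod_is h).2 uh.
have hp : (size h < size p)%N.
  by apply: leq_ltn_trans sh0; apply: minh; split=> //; apply/unimod_is.
have lhw : w (i (lead_coef h)) 1 by rewrite vr_is1.
(* If the residue of [z'] had a minimal polynomial of smaller degree, lifted to [h], then [p] would
   be [q * h] up to a remainder with zero reduction. *)
have [q [r [iq ir Ep sr]]] := integral_div ip uwh.1 lhw.
have h_neq0 := unimod_neq0 uh.
have Eqh : q * h = p - r by rewrite Ep addrK.
have sqh : size (q * h) = size p.
  by rewrite Eqh size_polyDl // size_polyN (ltn_trans sr).
have lqh : lead_coef q * lead_coef h = lead_coef p.
  by rewrite -lead_coefM Eqh lead_coefDl // size_polyN (ltn_trans sr).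
have uq : unimod w i q.
  apply: lead_unimod => //; rewrite -[X in w X _]mulr1.
  apply: vr_trans (_ : w (i (lead_coef q) * i (lead_coef h)) 1); last by rewrite -rmorphM lqh.
  by rewrite vrM //; apply: uwh.1.
have q0 := unimod_neq0 uq.
have sh1 : (1 < size h)%N.
  rewrite ltnNge; apply/negP => sh1; have /size_poly1P[c c0 Eh] : size h == 1%N.
    by rewrite eqn_leq sh1 size_poly_gt0.
  by move: smh lh; rewrite Eh map_polyC hornerC lead_coefC => /negP.
have sq : (size q < size p)%N.
  by rewrite -sqh size_mul // -subn1 -addnBA ?(ltnW sh1) // -[X in (X < _)%N]addn0 ltn_add2l subn_gt0.
have nur : forall k, vlt w 1 (i r`_k).
  move=> k; apply/negP => uk; have : resroot v s z' r.
    split; first by apply/unimod_is; split=> //; exists k.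
    have -> : r = p - q * h by rewrite Ep addrC addKr.
    rewrite rmorphB hornerD hornerN (rootP rz') rmorphM hornerM sub0r vltN mulrC.
    apply: vlt1Ml => //; apply: horner_integral => // m; apply: integral_map.
    exact: ((unimod_is q).1 uq).1.
  by move=> /minh; rewrite leqNgt sr.
(* Hence [q * h] has residue 0 at [y], although by minimality of [p] both factors are units
   there. *)
have : vlt w 1 ((map_poly i q).[y] * (map_poly i h).[y]).
  rewrite -hornerM -rmorphM /= Eqh rmorphB hornerD hornerN vltB //.
  by apply: horner_small => // k; rewrite coef_map; apply: nur.
apply/negP/negPn; rewrite -[X in w _ X]mulr1; apply: vrM; exact: small.
Qed.

(** Maximality puts the root [z] of [residue_root] in the image of [i]. Indeed a polynomial of
    smaller degree is a constant times a unimodular one, whose values at [z] and [z'] are units,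
    with the same leading term if [lead] holds. *)
Lemma residue_full y : w 1 y -> w y 1 -> exists c, near w (i c) y.
Proof.
move=> y1 yy1; have [p [z [z' [p0 [rz z1 yz] [rz' z'1 yz'] small]]]] := residue_root y1 yy1.
have [h h0 sh|c Ec] := maximal_is p0 rz rz'.
  have [c [q [c0 Eq sq uq]]] := unimod_scale w i h0.
  rewrite -sq in sh; have [qz qz'] := small _ uq sh.
  have uqv := (unimod_is q).1 uq.
  have qz1 : w 1 (map_poly i q).[z].
    by apply: horner_integral => // k; apply: integral_map uq.1.
  have qz1' : v 1 (map_poly s q).[z'].
    by apply: horner_integral => // k; apply: integral_map uqv.1.
  rewrite Eq !map_polyZ !hornerZ; split.
    rewrite mulf_neq0 ?fmorph_eq0 //; apply: contraTneq qz => ->.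
    by rewrite -/(vlt _ _ _); apply: contra (oner_neq0 L) => /vr0l->.
  apply: compat_unit => // l; have wv := lead_eq l.
  have y1v : v 1 y by rewrite -wv.
  rewrite /near (@vr_vlt_trans _ _ _ 1) ?orbT // -?wv // wv.
  have -> : (map_poly i q).[z] - (map_poly s q).[z'] =
      ((map_poly i q).[z] - (map_poly i q).[y]) + ((map_poly i q).[y] - (map_poly s q).[y])
      + ((map_poly s q).[y] - (map_poly s q).[z']) by rewrite !subrKA.
  apply: vltD; first apply: vltD.
  - apply: horner_cont => // [k||]; rewrite -?wv //; first exact: integral_map uq.1.
    by rewrite -opprB vltN.
  - by rewrite -opprB vltN; apply: horner_is.
  - apply: horner_cont => // [k|]; first exact: integral_map uqv.1.
    exact: yz'.
exists c; rewrite Ec; apply: near_sym; rewrite /near.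
by rewrite (vr_vlt_trans yy1 yz) orbT.
Qed.

(** Let [q] be least such that [r ^+ q] has a value from [F]. Adjoining a [q]-th root of a suitable
    [d] extends the embedding, because in degree below [q] one monomial always dominates; by
    maximality the root is already in the image. *)
Lemma value_full r : r != 0 -> exists c, w (i c) r /\ w r (i c).
Proof.
move=> r0; pose Q q := (0 < q)%N &&
  `[<exists d, [/\ d != 0, w (i d) (r ^+ q) & w (r ^+ q) (i d)]>].
have exQ : exists q, Q q.
  (* Otherwise one monomial of a polynomial vanishing at [r] would dominate there. *)
  apply: contrapT => nQ; have [p p0 rp] := alg_i r.
  have [|k [hk dom]] := @exists_dominant _ _ w i p r p0 r0.
    move=> k d /andP[k0 _] d0 [H1 H2]; apply: nQ; exists k; rewrite /Q k0 /=.
    by apply/asboolP; exists d.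
  have := dominant_near r0 (conj hk dom); rewrite (rootP rp) => /near_vr' /vr0l /eqP.
  by rewrite mulf_eq0 fmorph_eq0 expf_eq0 (negPf r0) andbF orbF (negPf hk).
case: (ex_minnP exQ) => q /andP[q0 /asboolP[d0 [d00 dr rd]]] minq.
have rq0 : r ^+ q != 0 by rewrite expf_neq0.
have id0 : i d0 != 0 by rewrite fmorph_eq0.
(* The factor [c] corrects [d0] so that [r ^+ q] and [i d] share their leading term, not only their
   value. *)
have [||c cn] := @residue_full (r ^+ q / i d0).
- by rewrite -(vrM2l w _ _ id0) mulr1 mulrC divfK.
- by rewrite -(vrM2l w _ _ id0) mulr1 mulrC divfK.
pose d := c * d0.
have dn : near w (r ^+ q) (i d).
  rewrite /d mulrC rmorphM -(divfK id0 (r ^+ q)) mulrC.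
  by apply: nearM2l; apply: near_sym.
have [z zq rz] := root_near q0 r0 dn.
have z0 : z != 0 := near_neq0 r0 rz.
have [z' z'q rz'] : exists2 z', z' ^+ q = s d & lead -> near v z z'.
  have [l|nl] := boolP lead.
    have wv := lead_eq l.
    have [|z' ? ?] := @root_near _ v z (s d) q q0 z0; last by exists z'.
    by rewrite zq; have [_] := compat_is d; apply.
  have [|z'] := closed_rootP ('X^q - (s d)%:P) _; first by rewrite size_XnsubC // eqSS -lt0n.
  by rewrite rootE !hornerE subr_eq0 => /eqP z'q; exists z'.
have z'0 : z' != 0.
  have := expf_neq0 q z0; rewrite zq fmorph_eq0 => d_neq0.
  by apply: contraNneq d_neq0 => z'0; move/eqP: z'q; rewrite z'0 expr0n -(prednK q0) eq_sym fmorph_eq0.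
(* Monomials in [z] and in [z'] are compared through their [q]-th powers, which lie in the images of
   [F]. *)
have T c1 c2 k1 k2 : w (i c1 * z ^+ k1) (i c2 * z ^+ k2)
    = v (s c1 * z' ^+ k1) (s c2 * z' ^+ k2).
  rewrite -(vrXE w _ _ q0) -(vrXE v _ _ q0) !exprMn !(exprAC _ _ q) zq z'q.
  by rewrite -!rmorphXn -!rmorphM vr_is.
pose p : {poly F} := 'X^q - d%:P.
have sp : size p = q.+1 by rewrite size_XnsubC.
have [||||t tz] := @maximal_is p z z'.
- by rewrite -size_poly_gt0 sp.
- by rewrite rmorphB /= map_polyXn map_polyC rootE !hornerE zq subrr.
- by rewrite rmorphB /= map_polyXn map_polyC rootE !hornerE z'q subrr.
- move=> h h0; rewrite sp ltnS => sh.
  have [|k dk] := @exists_dominant _ _ w i h z h0 z0.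
    move=> k e /andP[k0 kh] e0 [H1 H2]; have : Q k.
      have [rz1 rz2] := nearP (nearX k rz).
      rewrite /Q k0; apply/asboolP; exists e; split=> //; first exact: vr_trans H1 rz2.
      exact: vr_trans rz1 H2.
    by move=> /minq; rewrite leqNgt (leq_trans kh sh).
  have dk' : dominant v s h z' k.
    by case: dk => hk dk; split=> // m mk; rewrite /vlt -T; apply: dk.
  have n := dominant_near z0 dk; have n' := dominant_near z'0 dk'; split.
    apply: near_neq0 n; rewrite mulf_neq0 ?expf_neq0 // fmorph_eq0.
    by case: dk.
  apply: compat_near n n'; split.
    by have := T 1 h`_k 0%N k; rewrite !rmorph1 !expr0 !mulr1.
  by move=> l; apply: nearM; [have [_] := compat_is h`_k; apply|apply: nearX; apply: rz'].
by exists t; rewrite tz; have [] := nearP rz.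
Qed.

(** If the best approximation [i a] were not exact, [value_full] and [residue_full] would provide
    the leading term of [y - i a], and adding it to [a] would improve the approximation. *)
Lemma maximal_full y : exists c, i c = y.
Proof.
have [a amax] := best_approx y.
apply: contrapT => ny; have ya : y - i a != 0.
  by rewrite subr_eq0; apply: contra_notN ny => /eqP->; exists a.
have [c [cy yc]] := value_full ya.
have ic0 : i c != 0 by apply: contraTneq cy => ->; apply: contra ya => /vr0l->.
have [||d dn] := @residue_full ((y - i a) / i c).
- by rewrite -(vrM2l w _ _ ic0) mulr1 mulrC divfK.
- by rewrite -(vrM2l w _ _ ic0) mulr1 mulrC divfK.
have /(near_vlt ya) : near w (y - i a) (i (d * c)).
  rewrite mulrC rmorphM -[y - i a](divfK ic0) mulrC; apply: nearM2l; exact: near_sym.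
by apply/negP; have := amax (a + d * c); rewrite rmorphD opprD addrA.
Qed.
End MaximalEmbedding.

(** * Extension of embeddings *)

Section SubfieldType.
Context (R : comUnitRingType) (G : {pred R}).
Hypotheses (hG : divring_closed G) (unitG : {in G, forall y : R, y != 0 -> y \is a GRing.unit}).

(** The proofs are arguments so that the instances below can be attached to the predicate. [R] is
    not assumed to be a field because subfields of [L * L] will serve as graphs of embeddings. *)
Definition field_pred of divring_closed G &
  {in G, forall y : R, y != 0 -> y \is a GRing.unit} : {pred R} := G.
Local Notation pG := (field_pred hG unitG).

HB.instance Definition _ := GRing.isDivringClosed.Build R pG hG.

Record subfld := Subfld { subfld_val : R; _ : subfld_val \in pG }.

HB.instance Definition _ := [isSub for subfld_val].
HB.instance Definition _ := [Choice of subfld by <:].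
HB.instance Definition _ := [SubChoice_isSubComUnitRing of subfld by <:].

Lemma subfld_field : GRing.field_axiom subfld.
Proof.
move=> z z0; have zG : val z \in pG by apply: valP.
have uz : val z \is a GRing.unit by apply: unitG => //; rewrite -(rmorph0 val) (inj_eq val_inj).
have zVG : (val z)^-1 \in pG by rewrite rpredV.
by apply/unitrP; exists (Subfld zVG); split; apply: val_inj; rewrite rmorphM rmorph1 /= ?mulVr ?divrr.
Qed.
HB.instance Definition _ := GRing.ComUnitRing_isField.Build subfld subfld_field.

Lemma subfldP (z : subfld) : val z \in G.
Proof. exact: (valP z). Qed.
End SubfieldType.

Lemma zorn_above (T : Type) (good : (T -> Prop) -> Prop) (A0 : T -> Prop) :
  good A0 ->
  (forall C : (T -> Prop) -> Prop, (exists A, C A) -> (forall A, C A -> good A) ->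
    (forall A B, C A -> C B -> (forall t, A t -> B t) \/ (forall t, B t -> A t)) ->
    good (fun t => exists2 A, C A & A t)) ->
  exists A, [/\ good A, forall t, A0 t -> A t &
    forall B, good B -> (forall t, A t -> B t) -> forall t, B t -> A t].
Proof.
(* Joining [A0] to every set forces it into the maximal one and takes care of the empty chain. *)
move=> good0 chain; pose up (A : T -> Prop) t := A0 t \/ A t.
have [C gC tC|A [gA maxA]] := @classical_sets.Zorn_bigcup T (fun A => good (up A)).
  have -> : up (classical_sets.bigcup C id) =
      (fun t => exists2 A, (exists2 B, (B = A0 \/ C B) & A = up B) & A t).
    apply: funext => t; apply: propext; split.
      case=> [t0|[B CB Bt]].
        by exists (up A0); [exists A0; [left|]|left].
      by exists (up B); [exists B; [right|]|right].
    case=> _ [B CB ->] [|Bt]; first by left.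
    case: CB Bt => [->|CB Bt]; first by left.
    by right; exists B.
  apply: chain.
  - by exists (up A0), A0; [left|].
  - move=> _ [B [->|CB] ->]; last exact: gC.
    by have -> : up A0 = A0 by apply: funext => t; apply: propext; split=> [[]|]; [| |right].
  - move=> _ _ [A CA ->] [B CB ->].
    case: CA => [->|CA]; first by left => t [|] ?; left.
    case: CB => [->|CB]; first by right => t [|] ?; left.
    by have [AB|BA] := tC _ _ CA CB; [left|right] => t [?|h]; [left|right; apply: AB|left|right; apply: BA].
exists (up A); split=> // [t ?|B gB AB t Bt]; first by left.
apply: contrapT => nAt; apply: (maxA B); last first.
  have -> // : up B = B.
  by apply: funext => s; apply: propext; split=> [[?|]|]; [apply: AB; left| |right].
split=> [s As|BA]; first by apply: AB; right.
by apply: nAt; right; apply: BA.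
Qed.

(** All requirements concern at most two elements at a time, so they pass to unions of chains. *)
Lemma maximal_subfield (R : comUnitRingType) (Q : R -> Prop) (G0 : {pred R}) :
  divring_closed G0 -> {in G0, forall y : R, y != 0 -> y \is a GRing.unit} ->
  {in G0, forall y, Q y} ->
  exists G : {pred R}, [/\ divring_closed G,
    {in G, forall y : R, y != 0 -> y \is a GRing.unit}, {in G, forall y, Q y},
    {subset G0 <= G} &
    forall H : {pred R}, divring_closed H ->
      {in H, forall y : R, y != 0 -> y \is a GRing.unit} -> {in H, forall y, Q y} ->
      {subset G <= H} -> {subset H <= G}].
Proof.
move=> cl0 u0 Q0; pose mk (A : R -> Prop) : {pred R} := [pred y | `[<A y>]].
have mkE A y : (y \in mk A) = `[<A y>] by [].
pose good A := [/\ divring_closed (mk A),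
  {in mk A, forall y : R, y != 0 -> y \is a GRing.unit} & {in mk A, forall y, Q y}].
have mkK (G : {pred R}) : mk (fun y => y \in G) = G.
  by apply: funext => y; apply: asboolb.
have [||A [[clA uA QA] A0 maxA]] := @zorn_above R good (fun y => y \in G0).
- by rewrite /good mkK.
- move=> C [A CA] gC tC.
  have two x y : (exists2 B, C B & B x) -> (exists2 B, C B & B y) ->
      exists2 B, C B & B x /\ B y.
    move=> [B CB Bx] [D CD Dy]; have [BD|DB] := tC _ _ CB CD.
      by exists D => //; split=> //; apply: BD.
    by exists B => //; split=> //; apply: DB.
  split.
  + have [[c1 _ _] _ _] := gC _ CA; split=> [|x y|x y].
    * by rewrite mkE; apply/asboolP; exists A => //; apply/asboolP.
    * rewrite !mkE => /asboolP Hx /asboolP Hy; have [B CB [Bx By]] := two _ _ Hx Hy.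
      have [[_ cB _] _ _] := gC _ CB; apply/asboolP; exists B => //.
      by apply/asboolP; apply: cB; apply/asboolP.
    * rewrite !mkE => /asboolP Hx /asboolP Hy; have [B CB [Bx By]] := two _ _ Hx Hy.
      have [[_ _ cB] _ _] := gC _ CB; apply/asboolP; exists B => //.
      by apply/asboolP; apply: cB; apply/asboolP.
  + move=> x; rewrite mkE => /asboolP[B CB Bx]; have [_ uB _] := gC _ CB.
    by apply: uB; apply/asboolP.
  + move=> x; rewrite mkE => /asboolP[B CB Bx]; have [_ _ QB] := gC _ CB.
    by apply: QB; apply/asboolP.
exists (mk A); split=> // [y /A0 Ay|H clH uH QH AH y yH]; first exact/asboolP.
apply/asboolP; apply: (maxA (fun y => y \in H)) => //; first by rewrite /good mkK.
by move=> t At; apply: AH; apply/asboolP.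
Qed.

(** Division in [L * L] need not be componentwise when exactly one entry of the divisor vanishes. *)
Lemma pair_div (L : fieldType) (u u' w w' : L) : (w == 0) = (w' == 0) ->
  (u, u') / (w, w') = (u / w, u' / w').
Proof.
have [->|w0] := eqVneq w 0 => /esym w'0.
  by rewrite (eqP w'0) -[(0, 0)]/(0 : L * L) !invr0 !mulr0.
have {}w'0 : w' != 0 by rewrite w'0.
rewrite (@mulr1_eq _ (w, w') (w^-1, w'^-1)) //.
by congr pair; rewrite /= mulfV.
Qed.

Lemma diag_closed (L : fieldType) (G : {pred L * L}) :
  divring_closed G -> divring_closed [pred u | (u, u) \in G].
Proof.
case=> G1 GB GV; split=> [|u t uG tG|u t uG tG]; rewrite inE //.
  exact: (GB (u, u) (t, t)).
by rewrite -pair_div //; apply: GV.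
Qed.

Lemma rmorphism_of (A B : nzRingType) (f : A -> B) :
  {morph f : y z / y - z} -> {morph f : y z / y * z} -> f 1 = 1 ->
  exists g : {rmorphism A -> B}, g =1 f.
Proof.
move=> fB fM f1.
pose fa := GRing.isZmodMorphism.Build A B f fB.
pose fm := GRing.isMonoidMorphism.Build A B f (conj f1 fM).
pose g : {rmorphism A -> B} := HB.pack f fa fm.
by exists g.
Qed.

Lemma lift_poly (F L : fieldType) (j : {rmorphism F -> L}) (P : {poly L}) :
  (forall k, exists c, j c = P`_k) -> exists p, map_poly j p = P.
Proof.
move=> H; exists (\poly_(k < size P) sval (cid (H k))); apply/polyP => k.
rewrite coef_map coef_poly; case: ltnP => [_|kP]; first by case: cid.
by rewrite (nth_default _ kP); apply: rmorph0.
Qed.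

(** The gcd of [p] and [h] does not vanish at [y]; if it were not constant, its cofactor in [p]
    would vanish there with smaller degree. *)
Lemma minimal_coprime (F L : fieldType) (j : {rmorphism F -> L}) (p h : {poly F}) y :
  p != 0 -> root (map_poly j p) y ->
  (forall q : {poly F}, q != 0 -> (size q < size p)%N -> (map_poly j q).[y] != 0) ->
  (map_poly j h).[y] != 0 -> coprimep p h.
Proof.
move=> p0 rp minp hy; rewrite /coprimep eqn_leq size_poly_gt0 gcdp_eq0 (negPf p0) andbT.
rewrite leqNgt; apply/negP => sg; set g := gcdp p h in sg.
have gy : (map_poly j g).[y] != 0.
  have /dvdpP[q Eh] : g %| h := dvdp_gcdr _ _.
  by apply: contraNneq hy => gy; rewrite Eh rmorphM hornerM gy mulr0.
have /dvdpP[q Ep] : g %| p := dvdp_gcdl _ _.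
have q0 : q != 0 by apply: contraNneq p0 => q0; rewrite Ep q0 mul0r.
have g0 : g != 0 by apply: contraNneq p0 => g0; rewrite Ep g0 mulr0.
have sq : (size q < size p)%N.
  rewrite [p in X in (_ < X)%N]Ep size_mul // -subn1 -addnBA ?(ltnW sg) //.
  by rewrite -[X in (X < _)%N]addn0 ltn_add2l subn_gt0.
move: rp; rewrite rootE {1}Ep rmorphM hornerM mulf_eq0 (negPf gy) orbF.
by apply/negP; apply: minp.
Qed.

Section AdjoinGraph.
Context (F L : fieldType) (i s : {rmorphism F -> L}) (y y' : L).

(** Under the hypotheses below, the graph of the embedding of [i(F)(y)] that acts as [s] on [F] and
    sends [y] to [y']. *)
Definition adjoin_graph : {pred L * L} :=
  [pred x | `[<exists h, x = ((map_poly i h).[y], (map_poly s h).[y'])>]].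

Context (p : {poly F}) (p0 : p != 0).
Hypotheses (ry : root (map_poly i p) y) (ry' : root (map_poly s p) y').
Hypothesis minp : forall q : {poly F}, q != 0 -> (size q < size p)%N ->
  (map_poly i q).[y] != 0.

Let ev (h : {poly F}) : L * L := ((map_poly i h).[y], (map_poly s h).[y']).

Let HP x : reflect (exists h, x = ev h) (x \in adjoin_graph).
Proof. exact: asboolP. Qed.

Let ev1 : ev 1 = 1.
Proof. by rewrite /ev !rmorph1 !hornerC. Qed.

Let ev0 : ev 0 = 0.
Proof. by rewrite /ev !rmorph0 !horner0. Qed.

Let evB h1 h2 : ev (h1 - h2) = ev h1 - ev h2.
Proof. by rewrite /ev !rmorphB !hornerD !hornerN. Qed.

Let evD h1 h2 : ev (h1 + h2) = ev h1 + ev h2.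
Proof. by rewrite /ev !rmorphD !hornerD. Qed.

Let evM h1 h2 : ev (h1 * h2) = ev h1 * ev h2.
Proof. by rewrite /ev !rmorphM !hornerM. Qed.

Let evMp h : ev (h * p) = 0.
Proof. by rewrite evM /ev (rootP ry) (rootP ry') mulr0. Qed.

Let evp h : ev (h %% p) = ev h.
Proof. by rewrite [in RHS](divp_eq h p) evD evMp add0r. Qed.

(** Inverses come from a Bezout relation with [p], whose multiples [ev] kills. *)
Let evV h : ev h != 0 -> exists2 h', ev h * ev h' = 1 & ev h \is a GRing.unit.
Proof.
rewrite -evp; set g := h %% p => eh.
have g0 : g != 0 by apply: contraNneq eh => ->; rewrite ev0.
have gy : (map_poly i g).[y] != 0 := minp g0 (ltn_modpN0 _ p0).
have /Bezout_eq1_coprimepP[[a b] /= ab] := minimal_coprime p0 ry minp gy.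
have E : ev g * ev b = 1 by rewrite -ev1 -ab evD evMp add0r evM mulrC.
by exists b => //; apply/unitrP; exists (ev b); rewrite mulrC E.
Qed.

Lemma adjoin_graphP x : x \in adjoin_graph -> exists2 h : {poly F},
  (size h < size p)%N & x = ((map_poly i h).[y], (map_poly s h).[y']).
Proof.
by move=> /HP[h ->]; exists (h %% p); [apply: ltn_modpN0|rewrite -/(ev h) -evp].
Qed.

Lemma adjoin_graph_id c : (i c, s c) \in adjoin_graph.
Proof. by apply/HP; exists c%:P; rewrite /ev !map_polyC !hornerC. Qed.

Lemma adjoin_graphX : (y, y') \in adjoin_graph.
Proof. by apply/HP; exists 'X; rewrite /ev !map_polyX !hornerX. Qed.

Lemma adjoin_graph_unit : {in adjoin_graph, forall x : L * L, x != 0 -> x \is a GRing.unit}.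
Proof. by move=> _ /HP[h ->] /evV[]. Qed.

Lemma adjoin_graph_closed : divring_closed adjoin_graph.
Proof.
split=> [|_ _ /HP[h1 ->] /HP[h2 ->]|_ _ /HP[h1 ->] /HP[h2 ->]]; apply/HP.
- by exists 1.
- by exists (h1 - h2).
have [e0|/evV[h3 E3 u3]] := eqVneq (ev h2) 0.
  by exists 0; rewrite e0 invr0 mulr0 ev0.
by exists (h1 * h3); rewrite evM (mulr1_eq E3).
Qed.
End AdjoinGraph.

Section Extension.
Context (L : closedFieldType) (w v : valrel L) (lead : bool) (G0 : {pred L * L}).
Hypothesis lead_eq : lead -> w = v.
Hypothesis cl0 : divring_closed G0.
Hypothesis unit0 : {in G0, forall y : L * L, y != 0 -> y \is a GRing.unit}.
Hypothesis compat0 : {in G0, forall y : L * L, compat w v lead y.1 y.2}.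
Hypothesis alg0 : forall y, exists2 P : {poly L}, P != 0 /\ root P y &
  forall k, exists c, (P`_k, c) \in G0.

Section MaximalGraph.
Context (G : {pred L * L}) (clG : divring_closed G).
Hypothesis unitG : {in G, forall y : L * L, y != 0 -> y \is a GRing.unit}.
Hypothesis compatG : {in G, forall y : L * L, compat w v lead y.1 y.2}.
Hypothesis subG : {subset G0 <= G}.
Hypothesis maxG : forall H : {pred L * L}, divring_closed H ->
  {in H, forall y : L * L, y != 0 -> y \is a GRing.unit} ->
  {in H, forall y : L * L, compat w v lead y.1 y.2} ->
  {subset G <= H} -> {subset H <= G}.

Local Notation F := (subfld clG unitG).
Let i : {rmorphism F -> L} := @fst L L \o val.
Let s : {rmorphism F -> L} := @snd L L \o val.

(** The graph of the extension by [y] meets the requirements of [maxG], hence is contained in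
    [G]. *)
Lemma maximal_graph (p : {poly F}) y y' : p != 0 ->
  root (map_poly i p) y -> root (map_poly s p) y' ->
  (forall h : {poly F}, h != 0 -> (size h < size p)%N ->
     (map_poly i h).[y] != 0 /\
     compat w v lead (map_poly i h).[y] (map_poly s h).[y']) ->
  exists c, i c = y.
Proof.
move=> p0 ry ry' small.
have minp (h : {poly F}) : h != 0 -> (size h < size p)%N -> (map_poly i h).[y] != 0.
  by move=> h0 sh; have [] := small _ h0 sh.
have yG : (y, y') \in G.
  apply: (maxG (H := adjoin_graph i s y y')); last exact: adjoin_graphX.
  - exact: adjoin_graph_closed p0 ry ry' minp.
  - exact: adjoin_graph_unit p0 ry ry' minp.
  - move=> _ /(adjoin_graphP p0 ry ry')[h sh ->].
    have [->|h0] := eqVneq h 0; last by have [] := small _ h0 sh.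
    by rewrite !rmorph0 !horner0 /= -{1}(rmorph0 i) -(rmorph0 s); apply/compatG/subfldP.
  - move=> [c c'] cG.
    exact: (adjoin_graph_id i s y y' (Subfld (cG : (c, c') \in field_pred clG unitG))).
by exists (Subfld (yG : (y, y') \in field_pred clG unitG)).
Qed.

Lemma maximal_graph_total y : exists c, i c = y.
Proof.
apply: (@maximal_full L w v lead lead_eq F i s) => [c||z]; first exact/compatG/subfldP.
  exact: maximal_graph.
have [P [P0 rP] HP] := alg0 z.
have [|p Ep] := @lift_poly F L i P; last first.
  by exists p; rewrite ?Ep // -(map_poly_eq0 i) Ep.
move=> k; have [c /subG cG] := HP k.
by exists (Subfld (cG : (P`_k, c) \in field_pred clG unitG)).
Qed.
End MaximalGraph.

(** The first projection of a maximal graph is injective, the graph being a field, and onto by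
    [maximal_graph_total]; [f] is its inverse followed by the second projection. *)
Lemma extend_graph : exists f : {rmorphism L -> L},
  {in G0, forall y, f y.1 = y.2} /\ forall c, compat w v lead c (f c).
Proof.
have [G [clG uG cG sG mG]] := maximal_subfield cl0 unit0 compat0.
pose F := subfld clG uG; pose i : {rmorphism F -> L} := @fst L L \o val.
pose s : {rmorphism F -> L} := @snd L L \o val.
have tot : forall y, exists c, i c = y by apply: maximal_graph_total.
pose g y := sval (cid (tot y)); have gK y : i (g y) = y by rewrite /g; case: cid.
have [|||f Ef] := @rmorphism_of L F g.
- by move=> y z; apply: (fmorph_inj i); rewrite rmorphB (gK y) (gK z); exact: gK.
- by move=> y z; apply: (fmorph_inj i); rewrite rmorphM (gK y) (gK z); exact: gK.
- by apply: (fmorph_inj i); rewrite rmorph1; exact: gK.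
exists (s \o f); split=> [[c c'] c0|c].
  have cG' := sG _ c0; pose z : F := Subfld (cG' : (c, c') \in field_pred clG uG).
  by rewrite /= Ef (_ : g c = z) //; apply: (fmorph_inj i); exact: gK.
have : compat w v lead (i (g c)) (s (g c)) := cG _ (subfldP (g c)).
by rewrite gK /= Ef.
Qed.
End Extension.

(** * Subfields of an algebraically closed field *)

Section Subfields.
Context (L : fieldType).
Implicit Types (F E : {pred L}).

Lemma pred_unit F : {in F, forall y : L, y != 0 -> y \is a GRing.unit}.
Proof. by move=> y _; rewrite unitfE. Qed.

Definition sf F (hF : divring_closed F) : fieldType := subfld hF (@pred_unit F).
Definition sfval F (hF : divring_closed F) : {rmorphism sf hF -> L} := val.

Lemma sfvalP F (hF : divring_closed F) c : sfval hF c \in F.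
Proof. exact: subfldP. Qed.

Lemma sfval_surj F (hF : divring_closed F) c : c \in F -> exists d, sfval hF d = c.
Proof. by move=> cF; exists (Subfld (cF : c \in field_pred hF (@pred_unit F))). Qed.

Lemma sfval_inj F (hF : divring_closed F) : injective (sfval hF).
Proof. exact: val_inj. Qed.

Lemma sf_inclusion F (hF : divring_closed F) E (hE : divring_closed E) :
  {subset F <= E} -> exists j : {rmorphism sf hF -> sf hE},
    forall c, sfval hE (j c) = sfval hF c.
Proof.
move=> FE; have H c : exists d, sfval hE d = sfval hF c.
  by apply: sfval_surj; apply: FE; apply: sfvalP.
pose f c := sval (cid (H c)); have fE c : sfval hE (f c) = sfval hF c by rewrite /f; case: cid.
have [|||j Ej] := @rmorphism_of _ _ f.
- by move=> y z; apply: (@sfval_inj _ hE); rewrite rmorphB !fE rmorphB.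
- by move=> y z; apply: (@sfval_inj _ hE); rewrite rmorphM !fE rmorphM.
- by apply: (@sfval_inj _ hE); rewrite fE !rmorph1.
by exists j => c; rewrite Ej.
Qed.

Lemma polyOver_coefP F (hF : divring_closed F) (P : {poly L}) :
  reflect (forall k, P`_k \in F) (P \is a polyOver F).
Proof. exact: (@polyOverP _ (field_pred hF (@pred_unit F))). Qed.

Lemma polyOver_sf F (hF : divring_closed F) (P : {poly L}) :
  P \is a polyOver F -> exists p, map_poly (sfval hF) p = P.
Proof.
by move=> /(polyOver_coefP hF) PF; apply: lift_poly => k; apply: sfval_surj.
Qed.

Lemma sf_polyOver F (hF : divring_closed F) p : map_poly (sfval hF) p \is a polyOver F.
Proof. by apply/(polyOver_coefP hF) => k; rewrite coef_map; apply: sfvalP. Qed.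

Lemma mem_algcl F z : reflect (exists P : {poly L},
  [/\ P \is a polyOver F, P != 0 & root P z]) (z \in algcl F).
Proof. exact: asboolP. Qed.

Lemma algclP F (hF : divring_closed F) z :
  reflect (algebraicOver (sfval hF) z) (z \in algcl F).
Proof.
apply: (iffP (mem_algcl F z)) => [[P [PF P0 rP]]|[p p0 rp]].
  have [p Ep] := polyOver_sf hF PF; exists p; rewrite ?Ep //.
  by rewrite -(map_poly_eq0 (sfval hF)) Ep.
by exists (map_poly (sfval hF) p); rewrite sf_polyOver map_poly_eq0.
Qed.

Lemma algcl_closed F : divring_closed F -> divring_closed (algcl F).
Proof.
move=> hF; split=> [|y z /(algclP hF) Hy /(algclP hF) Hz|y z /(algclP hF) Hy /(algclP hF) Hz].
- by apply/(algclP hF); apply: algebraic1.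
- by apply/(algclP hF); apply: algebraic_sub.
- by apply/(algclP hF); apply: algebraic_div.
Qed.

Lemma sub_algcl F : divring_closed F -> {subset F <= algcl F}.
Proof.
by move=> hF c /(sfval_surj hF)[d <-]; apply/(algclP hF); apply: algebraic_id.
Qed.

Lemma algclS F E : {subset F <= E} -> {subset algcl F <= algcl E}.
Proof.
move=> FE z /mem_algcl[P [PF P0 rP]]; apply/mem_algcl; exists P.
by split=> //; apply: (polyOverS FE).
Qed.

Lemma algcl_root F (hF : divring_closed F) (P : {poly L}) z :
  P \is a polyOver (algcl F) -> P != 0 -> root P z -> z \in algcl F.
Proof.
move=> /(polyOver_coefP (algcl_closed hF)) PF P0 rP; apply/(algclP hF)/integral_algebraic.
apply: (integral_root P0 rP) => c /(nthP 0)[k _ <-].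
by apply/integral_algebraic/(algclP hF)/PF.
Qed.

Lemma algcl_idem F : divring_closed F -> {subset algcl (algcl F) <= algcl F}.
Proof. by move=> hF z /mem_algcl[P [PF P0 rP]]; apply: algcl_root rP. Qed.

Lemma mem_adjoin F y z : reflect (forall M : {pred L}, divring_closed M ->
  {subset [predU1 y & F] <= M} -> z \in M) (z \in adjoin F y).
Proof. exact: asboolP. Qed.

Lemma adjoin_closed F y : divring_closed (adjoin F y).
Proof.
split=> [|u z /mem_adjoin Hu /mem_adjoin Hz|u z /mem_adjoin Hu /mem_adjoin Hz]; apply/mem_adjoin => M hM sM.
- by case: hM.
- by case: (hM) => _ H _; apply: H; [apply: Hu|apply: Hz].
- by case: (hM) => _ _ H; apply: H; [apply: Hu|apply: Hz].
Qed.

Lemma adjoin_id F y : y \in adjoin F y.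
Proof. by apply/mem_adjoin => M _ sM; apply: sM; rewrite inE eqxx. Qed.

Lemma sub_adjoin F y : {subset F <= adjoin F y}.
Proof. by move=> c cF; apply/mem_adjoin => M _ sM; apply: sM; rewrite inE cF orbT. Qed.

Lemma adjoin_min F y E : divring_closed E -> {subset F <= E} -> y \in E ->
  {subset adjoin F y <= E}.
Proof.
move=> hE FE yE z /mem_adjoin; apply=> // u; rewrite inE => /orP[/eqP->//|]; exact: FE.
Qed.

Lemma predI_closed F E : divring_closed F -> divring_closed E ->
  divring_closed [predI F & E].
Proof.
move=> [F1 FB FV] [E1 EB EV]; split=> [|y z /andP[? ?] /andP[? ?]|y z /andP[? ?] /andP[? ?]].
- by rewrite inE F1 E1.
- by rewrite inE FB ?EB.
- by rewrite inE FV ?EV.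
Qed.
End Subfields.

Section MinimalPoly.
Context (F L : fieldType) (j : {rmorphism F -> L}).

Lemma minimal_poly y : algebraicOver j y -> exists p : {poly F},
  [/\ p != 0, root (map_poly j p) y & forall q : {poly F}, q != 0 ->
    (size q < size p)%N -> (map_poly j q).[y] != 0].
Proof.
case=> q q0 rq; pose Q n := `[<exists p : {poly F}, [/\ p != 0, size p = n &
  root (map_poly j p) y]>].
have exQ : exists n, Q n by exists (size q); apply/asboolP; exists q.
case: (ex_minnP exQ) => n /asboolP[p [p0 sp rp]] minp; exists p; split=> // h h0.
rewrite ltnNge; apply: contraNneq => /eqP rh; rewrite sp; apply: minp.
by apply/asboolP; exists h.
Qed.

Lemma minimal_dvd (p h : {poly F}) y : p != 0 -> root (map_poly j p) y ->
  (forall q : {poly F}, q != 0 -> (size q < size p)%N -> (map_poly j q).[y] != 0) ->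
  root (map_poly j h) y -> p %| h.
Proof.
move=> p0 rp minp rh; rewrite /dvdp; apply/negPn/negP => m0.
have /negP := minp _ m0 (ltn_modpN0 _ p0); apply.
have -> : h %% p = h - h %/ p * p by rewrite {2}(divp_eq h p) addrC addKr.
by rewrite rmorphB rmorphM hornerD hornerN hornerM (rootP rh) (rootP rp) mulr0 subr0.
Qed.
End MinimalPoly.

Section AlgebraicClosure.
Context (L : closedFieldType) (K : {pred L}) (hK : divring_closed K).

Definition kbar := subfld (algcl_closed hK) (@pred_unit _ (algcl K)).
HB.instance Definition _ := GRing.Field.on kbar.

Lemma kbar_closed : GRing.closed_field_axiom kbar.
Proof.
move=> n P n0; pose Q : {poly kbar} := 'X^n - \poly_(k < n) P k.
have sQ : size Q = n.+1.
  by rewrite size_polyDl ?size_polyXn // size_polyN ltnS size_poly.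
pose i : {rmorphism kbar -> L} := val.
have [|z rz] := @closed_rootP L (map_poly i Q) _.
  by rewrite size_map_poly sQ eqSS -lt0n.
have zK : z \in algcl K.
  apply: (algcl_root hK) rz; last by rewrite map_poly_eq0 -size_poly_gt0 sQ.
  by apply/(polyOver_coefP (algcl_closed hK)) => k; rewrite coef_map; apply: subfldP.
exists (Subfld (zK : z \in field_pred (algcl_closed hK) (@pred_unit _ (algcl K)))).
set y := Subfld _; have : Q.[y] = 0.
  by apply: (fmorph_inj i); rewrite rmorph0 -horner_map /=; apply/rootP.
rewrite hornerD hornerN hornerXn => /eqP; rewrite subr_eq0 => /eqP->.
rewrite (horner_coef_wide _ (size_poly _ _)); apply: eq_bigr => k _.
by rewrite coef_poly ltn_ord.
Qed.
HB.instance Definition _ := Field_isAlgClosed.Build kbar kbar_closed.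

Definition kval : {rmorphism kbar -> L} := val.

Lemma kvalP c : kval c \in algcl K.
Proof. exact: subfldP. Qed.

Lemma kval_surj c : c \in algcl K -> exists d, kval d = c.
Proof. exact: (sfval_surj (algcl_closed hK)). Qed.

Lemma kval_inj : injective kval.
Proof. exact: val_inj. Qed.

Lemma kbar_endo (f : {rmorphism L -> L}) : {in K, forall c, f c = c} ->
  exists g : {rmorphism kbar -> kbar}, forall c, kval (g c) = f (kval c).
Proof.
move=> fK; have H c : exists d, kval d = f (kval c).
  apply: kval_surj; have /mem_algcl[P [PK P0 rP]] := kvalP c; apply/mem_algcl; exists P.
  split=> //; have -> : P = map_poly f P.
    by apply/polyP => k; rewrite coef_map; apply/esym/fK/(polyOver_coefP hK).
  by rewrite fmorph_root.
pose g c := sval (cid (H c)); have gE c : kval (g c) = f (kval c) by rewrite /g; case: cid.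
have [|||h Eh] := @rmorphism_of _ _ g.
- by move=> y z; apply: kval_inj; rewrite rmorphB !gE !rmorphB.
- by move=> y z; apply: kval_inj; rewrite rmorphM !gE !rmorphM.
- by apply: kval_inj; rewrite gE !rmorph1.
by exists h => c; rewrite Eh.
Qed.
End AlgebraicClosure.

(** * Concrete valuation relations *)

Section ValuationRelation.
Context (L : fieldType) (Gamma : oagType) (v : valuation L Gamma).

Lemma lev_add2l (g : Gamma) s t : lev (Defs.addv (Some g) s) (Defs.addv (Some g) t) = lev s t.
Proof.
case: s t => [h|] [k|] //=; rewrite ![g + _]addrC.
apply/idP/idP => [/(oag_lerD2r (- g))|]; last exact: oag_lerD2r.
by rewrite !addrK.
Qed.

Lemma valrel_total : total (fun y z => lev (v y) (v z)).
Proof.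
by move=> y z; case: (v y) (v z) => [g|] [h|] //=; apply: oag_total.
Qed.

Lemma valrel_trans : transitive (fun y z => lev (v y) (v z)).
Proof. by move=> y z t; apply: lev_trans. Qed.

Lemma valrelD y z t : lev (v y) (v z) -> lev (v y) (v t) -> lev (v y) (v (z + t)).
Proof. by move=> yz yt; apply: lev_trans (Defs.valD v z t); apply: lev_min. Qed.

Lemma valrelM c y z : c != 0 -> lev (v (c * y)) (v (c * z)) = lev (v y) (v z).
Proof.
move=> c0; rewrite !Defs.valM; case vc: (v c) => [g|]; first exact: lev_add2l.
by move/(Defs.val0E v): vc c0 => ->; rewrite eqxx.
Qed.

Lemma valrel0 y : lev (v 0) (v y) -> y = 0.
Proof.
have -> : v 0 = None by apply/Defs.val0E.
by case vy: (v y) => [g|] // _; apply/(Defs.val0E v).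
Qed.

Definition valrel_of : valrel L := ValRel valrel_total valrel_trans valrelD valrelM valrel0.

Lemma valrel_of1 y : valrel_of 1 y = lev (Some 0) (v y).
Proof. by rewrite /= Defs.val1. Qed.
End ValuationRelation.

Section TrivialValuation.
Context (L : fieldType).
Let triv (y z : L) := (y != 0) || (z == 0).

Let triv_total : total triv.
Proof. by move=> y z; rewrite /triv; case: (y == 0); case: (z == 0). Qed.

Let triv_trans : transitive triv.
Proof. by move=> y z t; rewrite /triv; case: (y == 0); case: (z == 0). Qed.

Let trivD y z t : triv y z -> triv y t -> triv y (z + t).
Proof.
by rewrite /triv; case: (y == 0) => //= /eqP-> /eqP->; rewrite addr0.
Qed.

Let trivM c y z : c != 0 -> triv (c * y) (c * z) = triv y z.
Proof. by move=> /negPf c0; rewrite /triv !mulf_eq0 c0. Qed.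

Let triv0 y : triv 0 y -> y = 0.
Proof. by rewrite /triv eqxx => /eqP. Qed.

(** For it all pairs are compatible when [lead] is false, which turns [extend_graph] into a
    statement about plain field embeddings. *)
Definition trivial_valrel : valrel L := ValRel triv_total triv_trans trivD trivM triv0.

Lemma trivial_valrel1 y : trivial_valrel 1 y.
Proof. by rewrite /= /triv oner_neq0. Qed.
End TrivialValuation.

Section Pullback.
Context (F L : fieldType) (v : valrel L) (j : {rmorphism F -> L}).
Let pull y z := v (j y) (j z).

Let pull_total : total pull.
Proof. by move=> y z; apply: vr_total. Qed.

Let pull_trans : transitive pull.
Proof. by move=> y z t; apply: vr_trans. Qed.

Let pullD y z t : pull y z -> pull y t -> pull y (z + t).
Proof. by rewrite /pull rmorphD; apply: vrD. Qed.

Let pullM c y z : c != 0 -> pull (c * y) (c * z) = pull y z.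
Proof. by move=> c0; rewrite /pull !rmorphM vrM2l // fmorph_eq0. Qed.

Let pull0 y : pull 0 y -> y = 0.
Proof. by rewrite /pull rmorph0 => /vr0l /eqP; rewrite fmorph_eq0 => /eqP. Qed.

Definition pullback : valrel F := ValRel pull_total pull_trans pullD pullM pull0.

Lemma pullbackE y z : pullback y z = v (j y) (j z).
Proof. by []. Qed.

Lemma pullback_near y z : near pullback y z = near v (j y) (j z).
Proof. by rewrite /near /vlt pullbackE rmorphB (inj_eq (fmorph_inj j)). Qed.
End Pullback.

Lemma vr1_vr (F L : fieldType) (w : valrel F) (v : valrel L) (j : {rmorphism F -> L}) :
  (forall c, w 1 c = v 1 (j c)) -> forall y z, w y z = v (j y) (j z).
Proof.
move=> H y z; have [->|y0] := eqVneq y 0.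
  rewrite rmorph0; apply/idP/idP => [/vr0l->|/vr0l/eqP]; first by rewrite rmorph0 vr_refl.
  by rewrite fmorph_eq0 => /eqP->; apply: vr_refl.
have jy0 : j y != 0 by rewrite fmorph_eq0.
rewrite -[y in LHS]mulr1 -[z in LHS](divfK y0) [_ * y]mulrC vrM2l // H.
by rewrite -(vrM2l v _ _ jy0) mulr1 -rmorphM mulrC divfK.
Qed.

(** * Conjugate valuations, conjugate roots and fixed elements *)

Section Conjugation.
Context (F : fieldType) (L : closedFieldType) (j : {rmorphism F -> L}).
Hypothesis alg_j : forall y, algebraicOver j y.

Lemma extend_rmorphism (w v : valrel L) (lead : bool) (s : {rmorphism F -> L}) :
  (lead -> w = v) -> (forall c, compat w v lead (j c) (s c)) ->
  exists f : {rmorphism L -> L}, (forall c, f (j c) = s c) /\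
    forall c, compat w v lead c (f c).
Proof.
move=> lead_eq H; pose G0 : {pred L * L} := [pred x | `[<exists c, x = (j c, s c)>]].
have GP x : reflect (exists c, x = (j c, s c)) (x \in G0) by apply: asboolP.
have cl0 : divring_closed G0.
  split=> [|_ _ /GP[c ->] /GP[d ->]|_ _ /GP[c ->] /GP[d ->]]; apply/GP.
  - by exists 1; rewrite !rmorph1.
  - by exists (c - d); rewrite !rmorphB.
  by exists (c / d); rewrite pair_div ?fmorph_eq0 // !fmorph_div.
have u0 : {in G0, forall y : L * L, y != 0 -> y \is a GRing.unit}.
  move=> _ /GP[c ->] c0; have {}c0 : c != 0.
    by apply: contraNneq c0 => ->; rewrite !rmorph0.
  by apply/andP; rewrite /= !unitfE !fmorph_eq0.
have [||f [f1 f2]] := extend_graph lead_eq cl0 u0.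
- by move=> _ /GP[c ->]; apply: H.
- move=> y; have [p p0 rp] := alg_j y; exists (map_poly j p); first by rewrite map_poly_eq0.
  by move=> k; exists (s p`_k); rewrite coef_map; apply/GP; exists p`_k.
by exists f; split=> // c; apply: (f1 (j c, s c)); apply/GP; exists c.
Qed.

(** The embedding [j] itself is extended to [L], with [w] on the source and [v] on the target. *)
Lemma conjugate_valuations (w v : valrel L) : (forall c, w 1 (j c) = v 1 (j c)) ->
  exists f : {rmorphism L -> L}, (forall c, f (j c) = j c) /\ forall c, w 1 c = v 1 (f c).
Proof.
move=> H; have [|c|f [f1 f2]] := @extend_rmorphism w v false j; [by []|by split|].
by exists f; split=> // c; have [] := f2 c.
Qed.

Lemma conjugate_roots (p : {poly F}) y y' : p != 0 -> root (map_poly j p) y ->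
  (forall q : {poly F}, q != 0 -> (size q < size p)%N -> (map_poly j q).[y] != 0) ->
  root (map_poly j p) y' ->
  exists f : {rmorphism L -> L}, (forall c, f (j c) = j c) /\ f y = y'.
Proof.
move=> p0 ry minp ry'.
have [||f [f1 _]] := @extend_graph L (trivial_valrel L) (trivial_valrel L) false
  (adjoin_graph j j y y') (fun _ => erefl) (adjoin_graph_closed p0 ry ry' minp)
  (adjoin_graph_unit p0 ry ry' minp).
- by move=> x _; split; rewrite ?trivial_valrel1.
- move=> z; have [q q0 rq] := alg_j z; exists (map_poly j q); first by rewrite map_poly_eq0.
  by move=> k; exists (j q`_k); rewrite coef_map; apply: adjoin_graph_id.
exists f; split=> [c|]; first by apply: (f1 (j c, j c)); apply: adjoin_graph_id.
by apply: (f1 (y, y')); apply: adjoin_graphX.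
Qed.

Lemma separable_roots (p : {poly F}) : p != 0 -> separable_poly p ->
  exists r : seq L, [/\ uniq r, size p = (size r).+1 & forall y, root (map_poly j p) y = (y \in r)].
Proof.
move=> p0 sp; have [r Er] := closed_field_poly_normal (map_poly j p).
have lc0 : lead_coef (map_poly j p) != 0 by rewrite lead_coef_eq0 map_poly_eq0.
exists r; split.
- rewrite -separable_prod_XsubC; move: sp; rewrite -(separable_map j) Er.
  by rewrite (eqp_separable (eqp_scale _ lc0)).
- by rewrite -(size_map_poly j) Er size_scale // size_prod_XsubC.
- by move=> y; rewrite Er rootZ // root_prod_XsubC.
Qed.

Lemma minimal_separable (p q : {poly F}) y : p != 0 -> root (map_poly j p) y ->
  (forall h : {poly F}, h != 0 -> (size h < size p)%N -> (map_poly j h).[y] != 0) ->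
  separable_poly q -> root (map_poly j q) y -> separable_poly p.
Proof. by move=> p0 rp minp sq rq; apply: dvdp_separable sq; apply: minimal_dvd rq. Qed.

(** Every root of the minimal polynomial of [y] is a conjugate of [y], hence equal to [y]; being
    separable, this polynomial is linear. *)
Lemma fixed_separable y (q : {poly F}) : separable_poly q -> root (map_poly j q) y ->
  (forall f : {rmorphism L -> L}, (forall c, f (j c) = j c) -> f y = y) ->
  exists c, j c = y.
Proof.
move=> sq rq fixy; have [p [p0 rp minp]] := minimal_poly (alg_j y).
have sp := minimal_separable p0 rp minp sq rq.
have [r [ur sr rE]] := separable_roots p0 sp.
have ry z : z \in r -> z = y.
  by rewrite -rE => rz; have [f [f1 <-]] := conjugate_roots p0 rp minp rz; rewrite fixy.
have s2 : size p = 2%N.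
  have yr : y \in r by rewrite -rE.
  case: r ur sr ry yr {rE} => [|z [|z' r]] // /andP[zz' _] _ ry _.
  have zy := ry z (mem_head _ _).
  have z'y : z' = y by apply: ry; rewrite in_cons mem_head orbT.
  by move: zz'; rewrite zy z'y mem_head.
have p1 : p`_1 != 0 by have := p0; rewrite -lead_coef_eq0 lead_coefE s2.
have := rp; rewrite rootE horner_coef size_map_poly s2 !big_ord_recl big_ord0 /=.
rewrite addr0 !coef_map expr0 mulr1 expr1 addrC addr_eq0 => /eqP E.
exists (- p`_0 / p`_1); rewrite fmorph_div rmorphN -E mulrC mulKf //.
by rewrite fmorph_eq0.
Qed.
End Conjugation.

(* Some power of an algebraic element is separable: in characteristic [p], a
   polynomial with zero derivative is a polynomial in ['X^p]. *)
Lemma separable_power (F L : fieldType) (j : {rmorphism F -> L}) y :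
  algebraicOver j y -> exists2 e, (0 < e)%N &
    exists2 q : {poly F}, separable_poly q & root (map_poly j q) (y ^+ e).
Proof.
case=> p p0 rp; have [n] := ubnP (size p); elim: n => // n IH in p p0 y rp *.
move=> /ltnSE sn; have alg_y : algebraicOver j y by exists p.
have [q [q0 rq minq]] := minimal_poly alg_y.
have sq : (size q <= n)%N.
  by apply: leq_trans sn; apply: dvdp_leq => //; apply: minimal_dvd rp.
have [d0|d_neq0] := eqVneq q^`() 0; last first.
  exists 1%N => //; exists q; rewrite // unlock; apply: (minimal_coprime q0 rq) => //.
  by apply: minq => //; apply: lt_size_deriv.
have sq1 : (1 < size q)%N.
  have := root_size_gt1 _ rq; rewrite map_poly_eq0 size_map_poly; exact.
have qd m : (m %:R : F) != 0 -> (0 < m)%N -> q`_m = 0.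
  case: m => // m m0 _; have := congr1 (fun r : {poly F} => r`_m) d0.
  rewrite coef_deriv coef0 -mulr_natr => /eqP; rewrite mulf_eq0 (negPf m0) orbF.
  by move/eqP.
have [c cF] : exists c, c \in [pchar F].
  apply: (@natf0_pchar F (size q).-1); first by rewrite -subn1 subn_gt0.
  apply/negPn/negP => m0; have := qd _ m0; rewrite -lead_coefE.
  by rewrite -subn1 subn_gt0 => /(_ sq1)/eqP; rewrite lead_coef_eq0 (negPf q0).
have c1 : (1 < c)%N by apply/prime_gt1/(pcharf_prime cF).
pose g := \poly_(k < size q) q`_(k * c).
have Eq : q = g \Po 'X^c.
  apply/polyP => m; rewrite coef_comp_poly_Xn ?(ltnW c1) //.
  case: ifP => [/dvdnP[k ->]|cm].
    rewrite mulnK ?(ltnW c1) // coef_poly; case: ltnP => // /leq_trans sk.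
    by rewrite nth_default // sk // leq_pmulr // ltnW.
  apply: qd; last by case: m cm; rewrite ?dvdn0.
  by rewrite -(dvdn_pcharf cF) cm.
have g0 : g != 0 by apply: contraNneq q0 => g0; rewrite Eq g0 comp_poly0.
have rg : root (map_poly j g) (y ^+ c).
  by move: rq; rewrite {1}Eq map_comp_poly map_polyXn /root horner_comp hornerXn.
have sg : (size g < n)%N.
  apply: leq_trans sq; have := size_comp_poly g 'X^c; rewrite -Eq size_polyXn /=.
  move: sq1; case: (size q) => [|[|m]] //= _ E; have : (0 < size g)%N by rewrite size_poly_gt0.
  case: (size g) E => [|[|k]] //= -> _.
  by rewrite ltnS -[X in (X < _)%N]muln1 ltn_pmul2l.
have [e e0 [h sh rh]] := IH _ g0 _ rg sg.
by exists (c * e)%N; [rewrite muln_gt0 e0 ltnW|exists h; rewrite // exprM].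
Qed.

Section Stable.
Context (F : fieldType) (L : closedFieldType) (j : {rmorphism F -> L}).

Lemma stable_roots (f : {rmorphism L -> L}) (r : seq L) : uniq r ->
  {in r, forall z, f z \in r} -> perm_eq [seq f z | z <- r] r.
Proof.
move=> ur fr; have um : uniq [seq f z | z <- r] by rewrite map_inj_uniq //; apply: fmorph_inj.
have sub : {subset [seq f z | z <- r] <= r} by move=> _ /mapP[z zr ->]; apply: fr.
have [] := uniq_min_size um sub; first by rewrite size_map.
by move=> _ E; apply: uniq_perm.
Qed.

Lemma endo_root (f : {rmorphism L -> L}) (p : {poly F}) y :
  (forall c, f (j c) = j c) -> root (map_poly j p) y -> root (map_poly j p) (f y).
Proof.
move=> fj; have -> : map_poly j p = map_poly f (map_poly j p) by rewrite -map_poly_comp; apply: eq_map_poly => c /=.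
by rewrite fmorph_root -map_poly_comp /=; congr root; apply: eq_map_poly => c /=.
Qed.

(** [f] permutes the finitely many roots of a polynomial vanishing at [y]. *)
Lemma endo_surj (f : {rmorphism L -> L}) y : (forall c, f (j c) = j c) ->
  algebraicOver j y -> exists z, f z = y.
Proof.
move=> fj [p p0 rp]; have [r Er] := closed_field_poly_normal (map_poly j p).
have rE z : root (map_poly j p) z = (z \in undup r).
  by rewrite mem_undup Er rootZ ?lead_coef_eq0 ?map_poly_eq0 // root_prod_XsubC.
have /perm_mem E : perm_eq [seq f z | z <- undup r] (undup r).
  by apply: stable_roots; rewrite ?undup_uniq // => z; rewrite -!rE; apply: endo_root.
by move: rp; rewrite rE -E => /mapP[z _ ->]; exists z.
Qed.
End Stable.

Section AdjoinDegree.
Context (L : fieldType) (F : {pred L}) (hF : divring_closed F) (y : L).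
Let j := sfval hF.
Context (p : {poly sf hF}) (p0 : p != 0) (rp : root (map_poly j p) y).
Hypothesis minp : forall q : {poly sf hF}, q != 0 -> (size q < size p)%N ->
  (map_poly j q).[y] != 0.

(** [F(y)] lies in the diagonal of the graph of its identity embedding, whose elements
    [adjoin_graphP] describes. *)
Lemma adjoin_poly z : z \in adjoin F y ->
  exists2 h : {poly sf hF}, (size h < size p)%N & z = (map_poly j h).[y].
Proof.
move=> zF; suff: (z, z) \in adjoin_graph j j y y.
  by move=> /(adjoin_graphP p0 rp rp)[h sh [-> _]]; exists h.
pose E : {pred L} := [pred z | (z, z) \in adjoin_graph j j y y].
apply: (adjoin_min (E := E)) zF.
- exact/diag_closed/(adjoin_graph_closed p0 rp rp minp).
- by move=> c /(sfval_surj hF)[d <-]; apply: adjoin_graph_id.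
- exact: adjoin_graphX.
Qed.

Lemma adjoinX k : y ^+ k \in adjoin F y.
Proof.
have [d Ed] := sfval_surj (adjoin_closed F y) (adjoin_id F y).
have -> : y ^+ k = sfval (adjoin_closed F y) (d ^+ k) by rewrite rmorphXn Ed.
exact: sfvalP.
Qed.

Lemma degree_adjoin : degree_is F (adjoin F y) (size p).-1.
Proof.
set n := (size p).-1; have sp : size p = n.+1 by rewrite prednK // size_poly_gt0.
exists (fun k => y ^+ k); split=> [k|z zF]; first exact: adjoinX.
have [h sh Ez] := adjoin_poly zF; rewrite sp ltnS in sh.
exists [ffun k : 'I_n => j h`_k]; split.
  split=> [k|]; first by rewrite ffunE; apply: sfvalP.
  rewrite Ez (@horner_coef_wide _ n) ?size_map_poly //.
  by apply: eq_bigr => k _; rewrite ffunE coef_map.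
move=> c [cF Ez']; have [g Eg] : exists g, map_poly j g = \poly_(k < n) (if insub k is Some k' then c k' else 0).
  apply: lift_poly => k; rewrite coef_poly; case: ltnP => kn; last by exists 0; rewrite rmorph0.
  by rewrite insubT; apply: sfval_surj.
have sg : (size g <= n)%N by rewrite -(size_map_poly j) Eg size_poly.
have Egy : (map_poly j g).[y] = z.
  rewrite Eg (@horner_coef_wide _ n) ?size_poly // Ez'; apply: eq_bigr => k _.
  by rewrite coef_poly ltn_ord valK.
have gh : h - g = 0.
  apply/eqP/negPn/negP => hg0; have := minp hg0; rewrite sp ltnS.
  rewrite (leq_trans (size_polyD _ _)) ?geq_max ?size_polyN ?sh ?sg // => /(_ isT).
  by rewrite rmorphB hornerD hornerN Egy -Ez subrr eqxx.
apply/ffunP => k; rewrite ffunE (subr0_eq gh).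
have := congr1 (fun q : {poly L} => q`_k) Eg.
by rewrite coef_map coef_poly ltn_ord valK.
Qed.
End AdjoinDegree.

Lemma near_morph (F L : fieldType) (w : valrel F) (v : valrel L) (j : {rmorphism F -> L}) :
  (forall c, w 1 c = v 1 (j c)) -> forall y z, near w y z = near v (j y) (j z).
Proof.
move=> H y z; rewrite /near /vlt (vr1_vr H) rmorphB.
by rewrite (inj_eq (fmorph_inj j)).
Qed.

(** * Henselian fields and the lower bound *)

Section Henselian.
Context (L : closedFieldType) (Gamma : oagType) (v : valuation L Gamma).
Let V := valrel_of v.

(** [v] composed with [f] is a valuation on [algcl N] that agrees with [v] on [N]. Here [f] is a
    mere function, so that maps defined only on Kbar are covered. *)
Lemma henselian_stable (N : {pred L}) (f : L -> L) : henselian v N ->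
  {in algcl N &, {morph f : y z / y + z}} -> {in algcl N &, {morph f : y z / y * z}} ->
  {in algcl N, forall y, f y = 0 <-> y = 0} -> {subset N <= algcl N} ->
  {in N, forall c, f c = c} -> {in algcl N, forall z, V 1 (f z) = V 1 z}.
Proof.
move=> hN fD fM f0 sN fN z zN; rewrite !valrel_of1; apply: (hN _ (fun z => v (f z))) => //.
  split=> [y yN|y t yN tN|y t yN tN].
  - by rewrite -(f0 y yN); apply: Defs.val0E.
  - by rewrite fM // Defs.valM.
  - by rewrite fD // Defs.valD.
by move=> c cN; rewrite /= fN.
Qed.

Context (K : {pred L}) (hK : divring_closed K).
Let Vb := pullback V (kval hK).

Lemma henselian_endo (N : {pred L}) (f : {rmorphism L -> L}) : henselian v N ->
  divring_closed N -> (forall z, z \in algcl N) -> {in N, forall c, f c = c} ->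
  forall z, V 1 (f z) = V 1 z.
Proof.
move=> hN cN alN fN z; apply: (henselian_stable (N := N)) => // [y t _ _|y t _ _|y _].
- exact: rmorphD.
- exact: rmorphM.
- by split=> [/eqP|->]; rewrite ?rmorph0 // fmorph_eq0 => /eqP.
Qed.

Lemma henselian_kbar (M : {pred L}) (f : {rmorphism kbar hK -> kbar hK}) :
  henselian v M -> divring_closed M -> {subset K <= M} -> {subset M <= algcl K} ->
  (forall c, kval hK c \in M -> f c = c) -> forall z, Vb 1 (f z) = Vb 1 z.
Proof.
move=> hM cM KM MK fM z.
have clM c : c \in algcl M -> c \in algcl K.
  by move=> /(algclS MK); apply: algcl_idem.
(* [f] is transported to a function on [L], with value 0 outside [algcl K]. *)
pose g y := if pselect (exists d, kval hK d = y) is left H then kval hK (f (sval (cid H))) else 0.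
have gE d : g (kval hK d) = kval hK (f d).
  rewrite /g; case: pselect => [H|]; last by case; exists d.
  by case: cid => d' /= /kval_inj ->.
rewrite !pullbackE !rmorph1 -gE.
have kz : kval hK z \in algcl M by apply: (algclS KM); apply: kvalP.
apply: (henselian_stable hM) kz => //.
- move=> y t /clM/(kval_surj hK)[y' <-] /clM/(kval_surj hK)[t' <-].
  by rewrite -rmorphD !gE !rmorphD.
- move=> y t /clM/(kval_surj hK)[y' <-] /clM/(kval_surj hK)[t' <-].
  by rewrite -rmorphM !gE !rmorphM.
- move=> y /clM/(kval_surj hK)[y' <-]; rewrite gE.
  by split=> /eqP; rewrite !fmorph_eq0 => /eqP->; rewrite ?rmorph0.
- exact: sub_algcl.
by move=> c cM'; have [d Ed] := kval_surj hK (MK c cM'); rewrite -Ed gE fM ?Ed.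
Qed.

Lemma kbar_algebraic (M : {pred L}) (hM : divring_closed M) (j : {rmorphism sf hM -> kbar hK}) :
  {subset K <= M} -> (forall c, kval hK (j c) = sfval hM c) -> forall y, algebraicOver j y.
Proof.
move=> KM jE y; have /(algclS KM)/(algclP hM)[p p0 rp] := kvalP y; exists p => //.
rewrite -(fmorph_root (kval hK)) -map_poly_comp; congr (root _ _): rp.
by apply: eq_map_poly => c; apply/esym/jE.
Qed.

(* Two extensions of the valuation are conjugate over [N :&: Kbar], and on each
   element the conjugation agrees with an automorphism over [N]. *)
Lemma henselian_constants (N : {pred L}) : divring_closed N -> henselian v N ->
  {subset K <= N} -> (forall z, z \in algcl N) -> henselian v [predI N & algcl K].
Proof.
move=> cN hN KN alN Gamma' w valw eqw; set M := [predI N & algcl K] in valw eqw *.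
have cM : divring_closed M := predI_closed cN (algcl_closed hK).
have MK : {subset M <= algcl K} by move=> c /andP[].
have KM : {subset K <= M} by move=> c cK; rewrite inE KN ?sub_algcl.
have inM c : kval hK c \in algcl M by apply: (algclS KM); apply: kvalP.
have valW : valuation_on predT (fun c => w (kval hK c)).
  case: valw => w0 wM wD; split=> [c _|c d _ _|c d _ _].
  - rewrite w0 //; split=> [/eqP|->]; last by rewrite rmorph0.
    by rewrite fmorph_eq0 => /eqP.
  - by rewrite rmorphM wM.
  - by rewrite rmorphD wD.
pose W := valrel_of (Valuation valW).
have [j jE] := sf_inclusion cM (algcl_closed hK) MK.
have [|f [fj fW]] := @conjugate_valuations _ (kbar hK) j (kbar_algebraic KM jE) W Vb.
  move=> c; rewrite valrel_of1 pullbackE rmorph1 valrel_of1.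
  have jM : kval hK (j c) \in M by rewrite (jE c : kval hK (j c) = sfval cM c) sfvalP.
  exact: eqw jM.
move=> z /(algclS MK)/(algcl_idem hK)/(kval_surj hK)[y <-].
have -> : lev (Some 0) (w (kval hK y)) = V 1 (kval hK (f y)).
  by have := fW y; rewrite valrel_of1 pullbackE rmorph1.
rewrite -(valrel_of1 v).
have algN u : algebraicOver (sfval cN) u by apply/algclP.
have [p [p0 rp minp]] := minimal_poly (algN (kval hK y)).
(* It is enough that [f y] is conjugate to [y] over [N]: an endomorphism over the henselian [N]
   carrying one to the other preserves the valuation ring. *)
suff rfy : root (map_poly (sfval cN) p) (kval hK (f y)).
  have [g [gN <-]] := conjugate_roots algN p0 rp minp rfy.
  apply: (henselian_endo hN) => // c /(sfval_surj cN)[d <-]; exact: gN.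
have lp0 : lead_coef p != 0 by rewrite lead_coef_eq0.
pose q := (lead_coef p)^-1 *: p.
have qE : map_poly (sfval cN) p = (sfval cN (lead_coef p)) *: map_poly (sfval cN) q.
  by rewrite -map_polyZ scalerA divff // scale1r.
have slp0 : sfval cN (lead_coef p) != 0 by rewrite fmorph_eq0.
move: rp; rewrite qE !rootZ // => rq.
(* The roots of the monic [q] are algebraic over [K], hence so are its coefficients. Thus [q] is
   defined over [M], and [f] maps its roots to roots. *)
have qK k : (map_poly (sfval cN) q)`_k \in algcl K.
  have [r Er] := closed_field_poly_normal (map_poly (sfval cN) q).
  move: Er; rewrite lead_coef_map lead_coefZ mulVf // rmorph1 scale1r => Er.
  have rK : {in r, forall t, t \in algcl K}.
    move=> t tr; have /mem_algcl[P [PK P0 rP]] := kvalP y.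
    apply/mem_algcl; exists P; split=> //.
    have [h Eh] := polyOver_sf cN (polyOverS KN PK).
    have dph : p %| h by apply: (minimal_dvd p0 _ minp); rewrite ?Eh // qE rootZ.
    rewrite -Eh; move: dph; rewrite -(dvdp_map (sfval cN)) => /root_dvdp; apply.
    by rewrite qE rootZ // Er root_prod_XsubC.
  pose A := field_pred (algcl_closed hK) (@pred_unit _ (algcl K)).
  have PA : \prod_(t <- r) ('X - t%:P) \is a polyOver A.
    by rewrite big_seq; apply: rpred_prod => t /rK tK; rewrite polyOverXsubC.
  have := (polyOver_coefP (algcl_closed hK) _) PA.
  by rewrite -Er.
have [Q EQ] : exists Q : {poly sf cM}, map_poly (sfval cM) Q = map_poly (sfval cN) q.
  apply: lift_poly => k; apply: sfval_surj; rewrite inE qK andbT coef_map; exact: sfvalP.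
have EQ' : map_poly (kval hK) (map_poly j Q) = map_poly (sfval cN) q.
  by rewrite -EQ -map_poly_comp; apply: eq_map_poly => c; apply: jE.
by rewrite -EQ' fmorph_root; apply: (endo_root fj); rewrite -(fmorph_root (kval hK)) EQ'.
Qed.
End Henselian.

(** * Minimal pairs and the ramification field *)

Section MinimalPair.
Context (L : closedFieldType) (Gamma : oagType) (v : valuation L Gamma).
Context (K : {pred L}) (x a : L) (gamma : Gamma).
Hypotheses (hK : divring_closed K) (ha : minimal_pair_of_definition v K x a gamma).
Let V := valrel_of v.

Lemma val_center : v (x - a) = Some gamma.
Proof.
have [[_ _ H] _] := ha; have := H 'X; rewrite hornerX => ->.
  rewrite /monomial_value size_polyX !big_ord_recl big_ord0 /= !coefX /=.
  have -> : v 0 = None by apply/Defs.val0E.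
  by rewrite Defs.val1 /= add0r mulr1n.
apply/(polyOver_coefP (algcl_closed hK)) => k; rewrite coefX.
have [c1 cB _] := algcl_closed hK.
by case: (k == 1%N); rewrite ?mulr0n // -(subrr (1 : L)) cB.
Qed.

(* For [c = h(a)] with [deg h < deg a], minimality of the pair makes [a] and [x]
   indistinguishable to the linear factors of [h]. *)
Lemma minimal_pair_near c : c \in adjoin K a ->
  exists2 e, e \in adjoin K x & near V c e.
Proof.
have [[aK _ _] mina] := ha; move/(algclP hK): (aK) => alga.
have [p [p0 rp minp]] := minimal_poly alga.
move=> /(adjoin_poly p0 rp minp)[h sh ->].
have [->|h0] := eqVneq h 0.
  exists 0; last by rewrite rmorph0 horner0 near_refl.
  by have [c1 cB _] := adjoin_closed K x; rewrite -(subrr (1 : L)) cB.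
pose H := map_poly (sfval hK) h.
exists H.[x].
  have cx := adjoin_closed K x; have [i iE] := sf_inclusion hK cx (@sub_adjoin _ K x).
  have [d Ed] := sfval_surj cx (adjoin_id K x).
  have -> : H.[x] = sfval cx (map_poly i h).[d]; last exact: sfvalP.
  rewrite -horner_map Ed -map_poly_comp; congr (_.[x]).
  by apply: eq_map_poly => c'; apply/esym/iE.
have [r Er] := closed_field_poly_normal H.
have E y : H.[y] = lead_coef H * \prod_(k < size r) (y - r`_k).
  rewrite {1}Er hornerZ horner_prod (big_nth 0) big_mkord; congr (_ * _).
  by apply: eq_bigr => k _; rewrite hornerXsubC.
rewrite -/H !E; apply: nearM2l; apply: near_prod => k; set z := r`_k.
have zr : z \in r by apply: mem_nth.
have -> : x - z = (a - z) + (x - a) by rewrite [RHS]addrC subrKA.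
(* If [v (a - z) >= gamma], minimality of the pair bounds the degree of [a] by that of [z], hence by
   that of [h]. *)
apply: vlt_near; rewrite /vlt /= val_center; apply/negP => le.
have rz : root H z by rewrite Er rootZ ?root_prod_XsubC // lead_coef_eq0 map_poly_eq0.
have zK : z \in algcl K by apply/(algclP hK); exists h.
have [q [q0 rq minq]] := minimal_poly ((algclP hK z) zK).
have := mina z zK le _ _ (degree_adjoin p0 rp minp) (degree_adjoin q0 rq minq).
have qh : (size q <= size h)%N by apply: dvdp_leq => //; apply: minimal_dvd rz.
rewrite leqNgt => /negP; apply; rewrite -ltnS !prednK ?size_poly_gt0 //.
exact: leq_ltn_trans qh sh.
Qed.

Context (N : {pred L}) (cN : divring_closed N) (hN : henselian v N).
Hypotheses (xN : {subset adjoin K x <= N}) (algN : forall z, z \in algcl N).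

(** [c] has the leading term of some [e] in [K(x)], which [f] fixes, and [f] preserves the relation
    [near] since [N] is henselian. *)
Lemma adjoin_center_near (f : {rmorphism L -> L}) : {in N, forall c, f c = c} ->
  {in adjoin K a, forall c, near V c (f c)}.
Proof.
move=> fN c /minimal_pair_near[e /xN eN ce].
have fV z : V 1 z = V 1 (f z) by rewrite (henselian_endo hN).
apply: near_trans (ce) _; rewrite -(fN e eN) -(near_morph fV); exact: near_sym.
Qed.

Let KN : {subset K <= N}.
Proof. by move=> c cK; apply: xN; apply: sub_adjoin. Qed.

(** [f] is known to keep leading terms only on [K(a)]. Its restriction to [K(b)] is therefore
    extended anew to Kbar by a map [s] that keeps all of them, and the definition of the
    ramification field applies to [s]. *)
Lemma ramification_fixed b (f : {rmorphism L -> L}) :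
  b \in adjoin K a -> b \in ramification_field v K -> {in N, forall c, f c = c} ->
  f b = b.
Proof.
move=> ba /andP[bs /asboolP br] fN.
have aK : a \in algcl K by have [[]] := ha.
have aKK : {subset adjoin K a <= algcl K}.
  by apply: adjoin_min (algcl_closed hK) _ aK; apply: sub_algcl.
have bK := aKK _ ba.
have fK : {in K, forall c, f c = c} by move=> c /KN/fN.
have [g gE] := kbar_endo hK fK.
have bKK : {subset adjoin K b <= algcl K}.
  by apply: adjoin_min (algcl_closed hK) _ bK; apply: sub_algcl.
have [j jE] := sf_inclusion (adjoin_closed K b) (algcl_closed hK) bKK.
pose Vb := pullback V (kval hK).
have algj : forall y, algebraicOver j y.
  exact: (kbar_algebraic (hM := adjoin_closed K b) (@sub_adjoin _ K b) jE).
pose gj : {rmorphism sf (adjoin_closed K b) -> kbar hK} := g \o j.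
have gjE c : gj c = g (j c) by [].
have [||s [s1 s2]] := @extend_rmorphism _ (kbar hK) j algj Vb Vb true gj.
- by [].
- move=> c; rewrite gjE; split=> [|_].
    by rewrite !pullbackE gE !rmorph1 (henselian_endo hN).
  rewrite pullback_near gE; apply: adjoin_center_near => //.
  rewrite (jE c : kval hK (j c) = _).
  apply: (adjoin_min (adjoin_closed K a) _ ba); last exact: sfvalP.
  exact: sub_adjoin.
have sK c : kval hK c \in K -> s c = c.
  move=> cK; have [d Ed] := sfval_surj (adjoin_closed K b) (sub_adjoin b cK).
  have <- : j d = c by apply: (@kval_inj _ K hK); rewrite -Ed; exact: jE.
  rewrite s1 gjE; apply: (@kval_inj _ K hK); rewrite gE fK //.
  by rewrite (jE d : kval hK (j d) = _) Ed.
pose t y := if pselect (exists d, kval hK d = y) is left H then kval hK (s (sval (cid H))) else y.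
have tE d : t (kval hK d) = kval hK (s d).
  rewrite /t; case: pselect => [H|]; last by case; exists d.
  by case: cid => d' /= /kval_inj ->.
have tb : t b = f b.
  have [d Ed] := sfval_surj (adjoin_closed K b) (adjoin_id K b).
  have Ejd : kval hK (j d) = b := etrans (jE d) Ed.
  have -> : t b = t (kval hK (j d)) by rewrite Ejd.
  by rewrite tE s1 gjE gE Ejd.
rewrite -tb; apply: br.
  have surj z := kval_surj hK (c := z).
  split.
  - by move=> _ /surj[y <-]; rewrite tE; apply: kvalP.
  - move=> _ /surj[y <-];
    have [i iE] := sf_inclusion hK (algcl_closed hK) (sub_algcl hK).
    have algi : algebraicOver i y by apply: (kbar_algebraic (hM := hK) _ iE).
    have si c : s (i c) = i c.
      by apply: sK; rewrite (iE c : kval hK (i c) = _); apply: sfvalP.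
    have [z <-] := endo_surj si algi.
    by exists (kval hK z); [apply: kvalP|rewrite tE].
  - by move=> _ _ /surj[y <-] /surj[z <-]; rewrite -rmorphD !tE rmorphD rmorphD.
  - by move=> _ _ /surj[y <-] /surj[z <-]; rewrite -rmorphM !tE rmorphM rmorphM.
  - move=> c cK; have [d Ed] := surj _ (sub_algcl hK cK).
    by rewrite -Ed tE sK ?Ed.
move=> c cs c0; have [d Ed] : exists d, kval hK d = c.
  apply: kval_surj; have /asboolP[P [PK sP rP]] := cs; apply/mem_algcl; exists P.
  by split=> //; apply: separable_poly_neq0.
rewrite -Ed tE; have [_ /(_ isT)] := s2 d; rewrite pullback_near => nd.
have kd0 : kval hK d != 0 by rewrite Ed.
by have := near_vlt kd0 nd; rewrite -opprB vltN.
Qed.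

(** [b] is separable over [K], hence over [N], and is fixed by every endomorphism over [N]. *)
Lemma ramification_mem b : b \in adjoin K a -> b \in ramification_field v K -> b \in N.
Proof.
move=> ba br; have /andP[/asboolP[P [PK sP rP]] _] := br.
have [p Ep] := polyOver_sf cN (polyOverS KN PK).
have [||||c <-] := @fixed_separable _ _ (sfval cN) _ b p; last exact: sfvalP.
- by move=> y; apply/algclP.
- by rewrite -(separable_map (sfval cN)) Ep.
- by rewrite Ep.
move=> f fj; apply: ramification_fixed => // c /(sfval_surj cN)[d <-]; exact: fj.
Qed.
End MinimalPair.

(** The ramification group lies in the inertia group: [v c >= 0] and [v (s c - c) > v c] give
    [v (s c - c) > 0]. Only [c = 0] is treated apart. *)
Lemma inertia_ramification (L : closedFieldType) (Gamma : oagType)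
    (v : valuation L Gamma) (K : {pred L}) : divring_closed K ->
  {subset inertia_field v K <= ramification_field v K}.
Proof.
move=> hK z /andP[zs /asboolP H]; apply/andP; split=> //; apply/asboolP => s sK sr.
apply: H => // c cs c0; have [->|cn0] := eqVneq c 0; last first.
  by apply: contra (sr c cs cn0) => le; apply: lev_trans le c0.
case: sK => _ _ sD _ _; have K0 : 0 \in algcl K.
  by have [c1 cB _] := algcl_closed hK; rewrite -(subrr (1 : L)) cB.
have /eqP := sD 0 0 K0 K0; rewrite addr0 -subr_eq0 opprD addNKr oppr_eq0 => /eqP->.
by rewrite subrr (_ : v 0 = None) //; apply/Defs.val0E.
Qed.

(** For each henselian [N] containing [K(x)], the constants of [N] form a henselian field containing
    [K(b)], hence its henselization. *)
Lemma henselization_constants (L : closedFieldType) (Gamma : oagType)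
    (v : valuation L Gamma) (K : {pred L}) (x a b : L) (gamma : Gamma) :
  divring_closed K -> (forall z, z \in algcl (adjoin K x)) ->
  minimal_pair_of_definition v K x a gamma ->
  b \in adjoin K a -> b \in ramification_field v K ->
  {subset henselization v (adjoin K b) <= implicit_constant_field v K x}.
Proof.
move=> hK alg ha ba br z /asboolP zH.
have aK : a \in algcl K by have [[]] := ha.
have cK := algcl_closed hK.
have bK : b \in algcl K by apply: adjoin_min ba => //; apply: sub_algcl.
have inN (N : {pred L}) : divring_closed N -> {subset adjoin K x <= N} -> henselian v N ->
    z \in [predI N & algcl K].
  move=> cN xN hN; have algN u : u \in algcl N by apply: (algclS xN).
  have KN : {subset K <= N} by move=> c cK'; apply: xN; apply: sub_adjoin.
  have bN : b \in N by apply: (ramification_mem hK ha cN hN xN).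
  apply: zH; first exact: predI_closed.
  - apply: adjoin_min; [exact: predI_closed| |by rewrite inE bN].
    by move=> c cK'; rewrite inE KN ?sub_algcl.
  - move=> c /andP[_]; apply: algclS; exact: sub_adjoin.
  - exact: henselian_constants.
rewrite inE; apply/andP; split.
  (* Omega itself is trivially henselian; taking it for [N] shows that [z] is algebraic over [K]. *)
  have predTc : divring_closed (@predT L) by [].
  have [] := andP (inN _ predTc _ _) => // Gamma' w _ e c _; exact: e.
by apply/asboolP => N cN xN _ hN; have /andP[] := inN N cN xN hN.
Qed.

(** * The upper bound *)

Section RationalGraph.
Context (A L : fieldType) (i s : {rmorphism A -> L}) (t : L).
Hypothesis ti : forall p : {poly A}, p != 0 -> (map_poly i p).[t] != 0.
Hypothesis ts : forall p : {poly A}, p != 0 -> (map_poly s p).[t] != 0.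

Let fr (p q : {poly A}) : L * L :=
  ((map_poly i p).[t] / (map_poly i q).[t], (map_poly s p).[t] / (map_poly s q).[t]).

(** Given [ti] and [ts], the graph of the embedding of [i(A)(t)] that acts as [s] on [A] and fixes
    [t]. *)
Definition rational_graph : {pred L * L} :=
  [pred u | `[<exists p q : {poly A}, q != 0 /\ u =
    ((map_poly i p).[t] / (map_poly i q).[t], (map_poly s p).[t] / (map_poly s q).[t])>]].

Lemma rational_graphP u : reflect (exists p q : {poly A}, q != 0 /\ u = fr p q)
  (u \in rational_graph).
Proof. exact: asboolP. Qed.

Lemma rational_graph_poly p :
  ((map_poly i p).[t], (map_poly s p).[t]) \in rational_graph.
Proof.
apply/rational_graphP; exists p, 1; rewrite oner_neq0; split=> //.
by rewrite /fr !rmorph1 !hornerC !divr1.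
Qed.

Lemma rational_graph_id c : (i c, s c) \in rational_graph.
Proof. by have := rational_graph_poly c%:P; rewrite !map_polyC !hornerC. Qed.

Lemma rational_graphX : (t, t) \in rational_graph.
Proof. by have := rational_graph_poly 'X; rewrite !map_polyX !hornerX. Qed.

Lemma rational_graph_closed : divring_closed rational_graph.
Proof.
split=> [|_ _ /rational_graphP[p [q [q0 ->]]] /rational_graphP[p' [q' [q'0 ->]]]|
  _ _ /rational_graphP[p [q [q0 ->]]] /rational_graphP[p' [q' [q'0 ->]]]].
- by have := rational_graph_id 1; rewrite !rmorph1.
- apply/rational_graphP; exists (p * q' - p' * q), (q * q'); split; first by rewrite mulf_neq0.
  rewrite /fr !rmorphB !rmorphM !hornerD !hornerN !hornerM.
  by congr pair; rewrite /= -mulNr addf_div ?ti ?ts // mulNr.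
apply/rational_graphP; have [p'0|p'0] := eqVneq p' 0.
  exists 0, 1; rewrite oner_neq0; split=> //.
  by rewrite p'0 /fr !rmorph0 !horner0 !mul0r -[(0, 0)]/(0 : L * L) invr0 mulr0.
exists (p * q'), (q * p'); split; first by rewrite mulf_neq0.
rewrite pair_div; last first.
  by rewrite !mulf_eq0 !invr_eq0 !(negPf (ti _)) ?(negPf (ts _)).
by rewrite /fr !rmorphM !hornerM !invf_div !mulf_div.
Qed.

Lemma rational_graph_unit :
  {in rational_graph, forall y : L * L, y != 0 -> y \is a GRing.unit}.
Proof.
move=> _ /rational_graphP[p [q [q0 ->]]] n0; have p0 : p != 0.
  by apply: contraNneq n0 => ->; rewrite /fr !rmorph0 !horner0 !mul0r.
by apply/andP; rewrite /= !unitfE !mulf_neq0 ?invr_eq0 ?ti ?ts.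
Qed.
End RationalGraph.

(* An endomorphism permuting the conjugates of [y] cannot move [y] upwards in an
   order that it preserves. *)
Lemma no_drift (F : fieldType) (L : closedFieldType) (j : {rmorphism F -> L})
    (f : {rmorphism L -> L}) (T : rel L) y :
  (forall c, f (j c) = j c) -> algebraicOver j y -> irreflexive T -> transitive T ->
  (forall z u, T z u -> T (f z) (f u)) -> ~~ T y (f y).
Proof.
move=> fj [p p0 rp] Tirr Ttr Tf; apply/negP => Ty.
have [r Er] := closed_field_poly_normal (map_poly j p).
have rE z : root (map_poly j p) z = (z \in r).
  by rewrite Er rootZ ?lead_coef_eq0 ?map_poly_eq0 // root_prod_XsubC.
(* The iterates of [y] would increase strictly, yet all are roots of [p]. *)
have step m : T (iter m f y) (iter m.+1 f y) by elim: m => // m IH; apply: Tf.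
have mono m n : T (iter m f y) (iter (m + n).+1 f y).
  elim: n => [|n IH]; first by rewrite addn0.
  by rewrite addnS; apply: Ttr IH (step _).
have neq m n : (m < n)%N -> iter m f y <> iter n f y.
  move=> mn E; have := mono m (n - m.+1)%N.
  by rewrite (_ : (m + (n - m.+1)).+1 = n) ?E ?Tirr // -addSn subnKC.
have inj : injective (fun m => iter m f y).
  by move=> m n E; case: (ltngtP m n) => // /neq; [case|case; symmetry].
suff: (size [seq iter m f y | m <- iota 0 (size r).+1] <= size r)%N.
  by rewrite size_map size_iota ltnn.
apply: uniq_leq_size; first by rewrite map_inj_uniq ?iota_uniq.
move=> _ /mapP[m _ ->]; rewrite -rE; elim: m => // m IH; exact: endo_root.
Qed.

Section Constants.
Context (L : closedFieldType) (Gamma : oagType) (v : valuation L Gamma).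
Context (K : {pred L}) (x a : L) (gamma : Gamma).
Hypotheses (hK : divring_closed K) (hx : x \notin algcl K).
Hypothesis algx : forall z, z \in algcl (adjoin K x).
Hypothesis ha : minimal_pair_of_definition v K x a gamma.
Context (M : {pred L}) (cM : divring_closed M) (hM : henselian v M).
Hypotheses (aM : {subset adjoin K a <= M}) (MK : {subset M <= algcl K}).
Let V := valrel_of v.
Let Vb := pullback V (kval hK).
Let t := x - a.

Let KM : {subset K <= M}.
Proof. by move=> c cK; apply: aM; apply: sub_adjoin. Qed.

Lemma center_transcendental (p : {poly kbar hK}) : p != 0 -> (map_poly (kval hK) p).[t] != 0.
Proof.
move=> p0; apply: contra hx => /eqP pt; have cK := algcl_closed hK.
have aK : a \in algcl K by have [[]] := ha.
have tK : t \in algcl K.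
  apply: (algcl_root hK (P := map_poly (kval hK) p)); last exact/rootP.
    by apply/(polyOver_coefP cK) => k; rewrite coef_map; apply: kvalP.
  by rewrite map_poly_eq0.
have -> : x = t - (0 - a) by rewrite sub0r opprK subrK.
have [c1 cB _] := cK; apply: (cB) => //; apply: (cB) => //.
by rewrite -(subrr (1 : L)) cB.
Qed.

Lemma lev_anti (s u : option Gamma) : lev s u -> lev u s -> s = u.
Proof. by case: s u => [g|] [h|] //= gh hg; congr Some; apply/Order.POrderTheory.le_anti/andP. Qed.

(** Henselianity gives the invariance of the valuation ring; by [no_drift] the value of [c] can then
    neither rise nor fall. *)
Lemma endo_value (f : {rmorphism kbar hK -> kbar hK}) :
  (forall c, kval hK c \in M -> f c = c) ->
  forall c, v (kval hK (f c)) = v (kval hK c).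
Proof.
move=> fM c; have fV z : Vb 1 z = Vb 1 (f z).
  by rewrite (henselian_kbar hM cM KM MK fM).
have [j jE] := sf_inclusion cM (algcl_closed hK) MK.
have alg : algebraicOver j c by apply: (kbar_algebraic (hM := cM) KM jE).
have fj d : f (j d) = j d.
  by apply: fM; rewrite (jE d : kval hK (j d) = _); apply: sfvalP.
apply: lev_anti.
  rewrite -[lev _ _]/(Vb (f c) c) -[Vb _ _]negbK.
  apply: (no_drift (T := vlt Vb) fj alg) => [z|z u w|z u]; first exact: vltxx.
    exact: vlt_trans.
  by rewrite /vlt (vr1_vr fV).
rewrite -[lev _ _]/(Vb c (f c)) -[Vb _ _]negbK.
apply: (no_drift (T := fun y z => vlt Vb z y) fj alg) => [z|z u w|z u]; first exact: vltxx.
  by move=> H1 H2; apply: vlt_trans H2 H1.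
by rewrite /vlt (vr1_vr fV).
Qed.

(** The field [M(t)], which is also [M(x)] because [a] lies in [M], taken as the diagonal of the
    graph of its identity. *)
Definition constant_ratfun : {pred L} :=
  [pred u | (u, u) \in rational_graph (sfval cM) (sfval cM) t].

Lemma center_transcendentalM (p : {poly sf cM}) : p != 0 -> (map_poly (sfval cM) p).[t] != 0.
Proof.
have [j jE] := sf_inclusion cM (algcl_closed hK) MK.
have -> : map_poly (sfval cM) p = map_poly (kval hK) (map_poly j p).
  by rewrite -map_poly_comp; apply: eq_map_poly => c; apply/esym/jE.
by move=> p0; apply: center_transcendental; rewrite map_poly_eq0.
Qed.

Lemma constant_ratfun_closed : divring_closed constant_ratfun.
Proof. by apply/diag_closed/rational_graph_closed; apply: center_transcendentalM. Qed.

Lemma sub_constant_ratfun : {subset M <= constant_ratfun}.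
Proof. by move=> c /(sfval_surj cM)[d <-]; apply: rational_graph_id. Qed.

Lemma adjoin_constant_ratfun : {subset adjoin K x <= constant_ratfun}.
Proof.
have cC := constant_ratfun_closed; apply: adjoin_min => //.
  by move=> c /KM; apply: sub_constant_ratfun.
have -> : x = t - (0 - a) by rewrite sub0r opprK subrK.
have [c1 cB _] := cC; have c0 : 0 \in constant_ratfun by rewrite -(subrr (1 : L)) cB.
have aC : a \in constant_ratfun by apply/sub_constant_ratfun/aM/adjoin_id.
by apply: (cB); [apply: rational_graphX|apply: cB].
Qed.

(** If [y = p(t) / q(t)], then [p - y q] vanishes at [t], which is transcendental over Kbar;
    comparing coefficients in the degree of [q] puts [y] in [M]. *)
Lemma constant_ratfun_mem z : z \in algcl K -> z \in constant_ratfun -> z \in M.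
Proof.
have [j jE] := sf_inclusion cM (algcl_closed hK) MK.
have jM p : map_poly (sfval cM) p = map_poly (kval hK) (map_poly j p).
  by rewrite -map_poly_comp; apply: eq_map_poly => c; apply/esym/jE.
move=> /(kval_surj hK)[y <-] /rational_graphP[p [q [q0 Epq]]].
have E : kval hK y = (map_poly (sfval cM) p).[t] / (map_poly (sfval cM) q).[t].
  by case: Epq.
have qt := center_transcendentalM q0.
pose h : {poly kbar hK} := map_poly j p - y *: map_poly j q.
have hE : map_poly (kval hK) h =
    map_poly (kval hK) (map_poly j p) - kval hK y *: map_poly (kval hK) (map_poly j q).
  apply/polyP => k; rewrite coef_map /h !coefB !coefZ !coef_map.
  by apply: etrans (rmorphB (kval hK) _ _) _; congr (_ - _); apply: rmorphM.
have [pq|pq] := eqVneq h 0; last first.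
  have := center_transcendental pq; rewrite hE hornerD hornerN hornerZ.
  by rewrite -!jM E divfK // subrr eqxx.
have lq : lead_coef q != 0 by rewrite lead_coef_eq0.
have := congr1 (fun g : {poly kbar hK} => g`_(size q).-1) pq.
rewrite coefB coefZ !coef_map coef0 -lead_coefE => /eqP; rewrite subr_eq0 => /eqP e.
have -> : y = j (p`_(size q).-1 / lead_coef q).
  by rewrite fmorph_div e mulfK // fmorph_eq0.
by rewrite (jE _ : kval hK (j _) = _); apply: sfvalP.
Qed.

(** [g] acts on the coefficients of polynomials in [t]. Preserving their values, it preserves
    [nu_(a, gamma)] and so the valuation ring of Kbar(x), and [extend_graph] applies. *)
Lemma extend_constants (g : {rmorphism kbar hK -> kbar hK}) :
  (forall c, kval hK c \in M -> g c = c) ->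
  exists f : {rmorphism L -> L}, [/\ {in constant_ratfun, forall u, f u = u},
    forall c, f (kval hK c) = kval hK (g c) & forall c, V 1 (f c) = V 1 c].
Proof.
move=> gM; pose s : {rmorphism kbar hK -> L} := kval hK \o g.
have sE (p : {poly kbar hK}) : map_poly s p = map_poly (kval hK) (map_poly g p).
  by rewrite -map_poly_comp; apply: eq_map_poly.
have ts (p : {poly kbar hK}) : p != 0 -> (map_poly s p).[t] != 0.
  by move=> p0; rewrite sE center_transcendental // map_poly_eq0.
have tv (p : {poly kbar hK}) : v (map_poly s p).[t] = v (map_poly (kval hK) p).[t].
  have [[_ _ mv] _] := ha; have cK := algcl_closed hK.
  rewrite sE !mv; first last.
  - by apply/(polyOver_coefP cK) => k; rewrite coef_map; apply: kvalP.
  - by apply/(polyOver_coefP cK) => k; rewrite coef_map; apply: kvalP.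
  rewrite /monomial_value !size_map_poly; apply: eq_bigr => k _.
  by rewrite !coef_map (endo_value gM).
have ti := center_transcendental.
have [||f [f1 f2]] := @extend_graph L V V false (rational_graph (kval hK) s t)
  (fun _ => erefl) (rational_graph_closed ti ts) (rational_graph_unit ti ts).
- move=> _ /rational_graphP[p [q [q0 ->]]]; split=> //=.
  have := tv p; have := tv q; set P := _.[t]; set P' := _.[t]; set Q := _.[t]; set Q' := _.[t].
  move=> eP eQ.
  have P0 : P != 0 := ts _ q0. have P'0 : P' != 0 := ti _ q0.
  rewrite -(valrelM v _ _ P'0) -[in RHS](valrelM v _ _ P0) !mulr1.
  by rewrite ![_ * (_ / _)]mulrC !divfK // eP eQ.
(* The domain of the graph is Kbar(t), described again as a diagonal; it contains [K(x)]. *)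
- have cG := rational_graph_closed ti ti.
  move=> y; have /mem_algcl[P [PK P0 rP]] := algx y; exists P => // k.
  have : P`_k \in [pred u | (u, u) \in rational_graph (kval hK) (kval hK) t].
    have cD := diag_closed cG.
    apply: (adjoin_min cD) (_ : P`_k \in adjoin K x).
    + by move=> c /(sub_algcl hK)/(kval_surj hK)[d <-]; apply: rational_graph_id.
    + have -> : x = t - (0 - a) by rewrite sub0r opprK subrK.
      have [c1 cB _] := cD; have c0 : 0 \in [pred u | (u, u) \in rational_graph (kval hK) (kval hK) t].
        by rewrite -(subrr (1 : L)) cB.
      have aD : a \in [pred u | (u, u) \in rational_graph (kval hK) (kval hK) t].
        have [|d <-] := @kval_surj _ _ hK a; last exact: rational_graph_id.
        by have [[]] := ha.
      by apply: (cB); [apply: rational_graphX|apply: cB].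
    + by apply/(polyOver_coefP (adjoin_closed K x)).
  by move=> /rational_graphP[p [q [q0 [-> _]]]]; eexists; apply/rational_graphP; exists p, q.
exists f; split.
(* On [M(t)] the coefficients are fixed by [g], so [(u, u)] is in the graph. *)
- move=> u /rational_graphP[p [q [q0 [Eu _]]]]; apply: (f1 (u, u)).
  have [j jE] := sf_inclusion cM (algcl_closed hK) MK.
  have jM h : map_poly (sfval cM) h = map_poly (kval hK) (map_poly j h).
    by rewrite -map_poly_comp; apply: eq_map_poly => c; apply/esym/jE.
  have jg h : map_poly g (map_poly j h) = map_poly j h.
    rewrite -map_poly_comp; apply: eq_map_poly => c /=; apply: gM.
    by rewrite (jE c : kval hK (j c) = _); apply: sfvalP.
  apply/rational_graphP; exists (map_poly j p), (map_poly j q).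
  by rewrite map_poly_eq0 !sE !jg -!jM -Eu.
- by move=> c; apply: (f1 (kval hK c, s c)); apply: rational_graph_id.
- by move=> c; have [-> _] := f2 c.
Qed.
End Constants.

(** * Two constructions of henselian overfields *)

Section HenselianOverfields.
Context (L : closedFieldType) (Gamma : oagType) (v : valuation L Gamma).
Context (C : {pred L}) (cC : divring_closed C) (algC : forall z, z \in algcl C).
Let V := valrel_of v.

Lemma valuation_total (N : {pred L}) (Gamma' : oagType) (w : L -> option Gamma') :
  {subset C <= N} -> valuation_on (algcl N) w -> valuation_on predT w.
Proof.
move=> CN [w0 wM wD]; have alN z : z \in algcl N by apply: (algclS CN).
by split=> [c _|c d _ _|c d _ _]; [apply: w0|apply: wM|apply: wD].
Qed.

Definition stabilizer (f : {rmorphism L -> L}) :=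
  {in C, forall c, f c = c} /\ forall c, V 1 (f c) = V 1 c.

(** The decomposition field of [v] over [C]. *)
Definition stable_field : {pred L} := [pred u | `[<forall f, stabilizer f -> f u = u>]].

Lemma stable_fieldP u : reflect (forall f, stabilizer f -> f u = u) (u \in stable_field).
Proof. exact: asboolP. Qed.

Lemma stable_field_closed : divring_closed stable_field.
Proof.
split=> [|y z /stable_fieldP Hy /stable_fieldP Hz|y z /stable_fieldP Hy /stable_fieldP Hz].
- by apply/stable_fieldP => f _; rewrite rmorph1.
- by apply/stable_fieldP => f Df; rewrite rmorphB Hy ?Hz.
- by apply/stable_fieldP => f Df; rewrite fmorph_div Hy ?Hz.
Qed.

Lemma sub_stable_field : {subset C <= stable_field}.
Proof. by move=> c cC'; apply/stable_fieldP => f [fC _]; apply: fC. Qed.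

(* The orbit of [y] under the stabilizer is the set of roots of a polynomial over
   the stable field. *)
Lemma stable_orbit (f : {rmorphism L -> L}) y : {in stable_field, forall c, f c = c} ->
  exists2 g, stabilizer g & f y = g y.
Proof.
move=> fN; have [p p0 rp] := (algclP cC y) (algC y).
have [r Er] := closed_field_poly_normal (map_poly (sfval cC) p).
have rE z : root (map_poly (sfval cC) p) z = (z \in r).
  by rewrite Er rootZ ?lead_coef_eq0 ?map_poly_eq0 // root_prod_XsubC.
have stab_r g : stabilizer g -> forall z, z \in r -> g z \in r.
  by move=> [gC _] z; rewrite -!rE; apply: endo_root => c; apply: gC; apply: sfvalP.
pose Y := undup [seq u <- r | `[<exists2 g, stabilizer g & u = g y>]].
have YP u : reflect (exists2 g, stabilizer g & u = g y) (u \in Y).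
  rewrite mem_undup mem_filter; apply: (iffP andP) => [[/asboolP]//|[g Dg ->]].
  split; first by apply/asboolP; exists g.
  by apply: stab_r => //; rewrite -rE.
pose Q := \prod_(u <- Y) ('X - u%:P).
have fixQ (g : {rmorphism L -> L}) : stabilizer g -> map_poly g Q = Q.
  move=> Dg; rewrite /Q rmorph_prod /=.
  transitivity (\prod_(u <- [seq g u | u <- Y]) ('X - u%:P)).
    by rewrite big_map; apply: eq_bigr => u _; rewrite rmorphB /= map_polyX map_polyC.
  apply: perm_big; apply: stable_roots; rewrite ?undup_uniq // => u /YP[h Dh ->].
  apply/YP; exists (g \o h) => //; split=> [c cC'|c].
    exact: etrans (congr1 g (Dh.1 c cC')) (Dg.1 c cC').
  exact: etrans (Dg.2 (h c)) (Dh.2 c).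
have fQ : map_poly f Q = Q.
  apply/polyP => k; rewrite coef_map; apply: fN; apply/stable_fieldP => g /fixQ E.
  by rewrite -[in RHS]E coef_map.
have yY : root Q y.
  rewrite root_prod_XsubC; apply/YP; exists (idfun : {rmorphism L -> L}) => //.
have : root Q (f y) by rewrite -fQ fmorph_root.
by rewrite root_prod_XsubC => /YP.
Qed.

(** Another extension [w] is conjugate to [v] by some [f] over the stable field. At each single
    element [f] agrees with a member of the stabilizer, so [w] and [v] have the same valuation
    ring. *)
Lemma stable_field_henselian : henselian v stable_field.
Proof.
move=> Gamma' w /(valuation_total sub_stable_field) valw eqw z _.
pose W := valrel_of (Valuation valw).
have cN := stable_field_closed.
have algN u : algebraicOver (sfval cN) u by apply/algclP; apply: algclS (algC u); apply: sub_stable_field.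
have [|f [fj fW]] := conjugate_valuations algN (w := W) (v := V).
  by move=> c; rewrite !valrel_of1; apply: eqw; apply: sfvalP.
have [|g [_ gV] fg] := @stable_orbit f z.
  by move=> c /(sfval_surj cN)[d <-]; apply: fj.
have -> : lev (Some 0) (w z) = V 1 (f z) by rewrite -fW valrel_of1.
by rewrite fg gV -(valrel_of1 v).
Qed.

(* A field maximal among those avoiding [z] is separably closed if [z] is fixed
   by all automorphisms, so that its valuation extends uniquely. *)
Lemma avoiding_henselian z : z \notin C ->
  (forall f : {rmorphism L -> L}, {in C, forall c, f c = c} -> f z = z) ->
  exists N : {pred L}, [/\ divring_closed N, {subset C <= N}, z \notin N & henselian v N].
Proof.
move=> zC fixz.
have [|N [cN _ zN CN maxN]] := maximal_subfield (Q := fun u => u != z) cC (@pred_unit _ C).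
  by move=> c cC'; apply: contraNneq zC => <-.
have {}zN : z \notin N by apply/negP => /zN; rewrite eqxx.
exists N; split=> //.
have algN u : algebraicOver (sfval cN) u by apply/algclP; apply: algclS (algC u).
(* Omega is purely inseparable over [N]: if a separable power [d] of [c] were outside [N], then [z]
   would lie in [N(d)] by maximality. *)
have power c : exists2 e, (0 < e)%N & c ^+ e \in N.
  have [e e0 [q sq rq]] := separable_power (algN c); exists e => //; set d := c ^+ e in rq *.
  apply/negPn/negP => dN; have [p [p0 rp minp]] := minimal_poly (algN d).
  have : z \in adjoin N d.
    apply/negPn/negP => zH; move/negP: dN; apply.
    apply: (maxN (adjoin N d)); last exact: adjoin_id.
    - exact: adjoin_closed.
    - exact: pred_unit.
    - by move=> u uH; apply: contraNneq zH => <-.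
    - exact: sub_adjoin.
  move=> /(adjoin_poly p0 rp minp)[h sh Ez].
  have [r [ur sr rE]] := separable_roots (sfval cN) p0 (minimal_separable p0 rp minp sq rq).
  have dr : d \in r by rewrite -rE.
  have r0 : (0 < size r)%N by case: r dr {ur sr rE}.
  (* As [z] is fixed, [h - z] vanishes at all conjugates of [d], which outnumber its degree; so [z]
     is the constant coefficient of [h] and lies in [N]. *)
  have : map_poly (sfval cN) h - z%:P = 0.
    apply/eqP/negPn/negP => h0; have : all (root (map_poly (sfval cN) h - z%:P)) r.
      apply/allP => d'; rewrite -rE => rd'.
      have [f [fj fd]] := conjugate_roots algN p0 rp minp rd'.
      have fz : f z = z.
        by apply: fixz => u /CN/(sfval_surj cN)[u' <-]; apply: fj.
      have fE : f z = (map_poly (sfval cN) h).[d'].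
        rewrite {1}Ez -fd -horner_map -map_poly_comp; congr (_.[_]).
        by apply: eq_map_poly => u; apply: fj.
      by rewrite /root !hornerE -fE fz subrr.
    move=> /(max_poly_roots h0)/(_ ur); rewrite ltnNge; apply/negP/negPn.
    apply: leq_trans (size_polyD _ _) _; rewrite geq_max size_polyN size_map_poly.
    by rewrite -ltnS -sr sh (leq_trans (size_polyC_leq1 _)).
  move/eqP; rewrite subr_eq0 => /eqP/(congr1 (fun g : {poly L} => g`_0)).
  rewrite coef_map coefC eqxx => E; move/negP: zN; apply; rewrite -E; exact: sfvalP.
move=> Gamma' w /(valuation_total CN) valw eqw c _; pose W := valrel_of (Valuation valw).
(* Membership in a valuation ring can be tested on a power. *)
have [e e0 ceN] := power c.
have eW : W 1 c = W 1 (c ^+ e) by rewrite -[in RHS](expr1n L e) vrXE.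
have eV : V 1 c = V 1 (c ^+ e) by rewrite -[in RHS](expr1n L e) vrXE.
have -> : lev (Some 0) (w c) = W 1 c by rewrite valrel_of1.
by rewrite eW -(valrel_of1 v) -/V eV !valrel_of1; apply: eqw.
Qed.
End HenselianOverfields.

(** For each henselian [M] as in the definition of [K(a)^h], a constant [z] outside [M] is excluded
    from some henselian field containing [K(x)]. *)
Lemma constants_henselization (L : closedFieldType) (Gamma : oagType)
    (v : valuation L Gamma) (K : {pred L}) (x a : L) (gamma : Gamma) :
  divring_closed K -> x \notin algcl K -> (forall z, z \in algcl (adjoin K x)) ->
  minimal_pair_of_definition v K x a gamma ->
  {subset implicit_constant_field v K x <= henselization v (adjoin K a)}.
Proof.
move=> hK hx algx ha z /andP[zK /asboolP zH]; apply/asboolP => M cM aM Ma hM.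
have aK : a \in algcl K by have [[]] := ha.
have MK : {subset M <= algcl K}.
  move=> c /Ma cMa; apply: algcl_idem => //; apply: algclS cMa.
  by apply: adjoin_min aK; [exact: algcl_closed|exact: sub_algcl].
have KM : {subset K <= M} by move=> c cK; apply: aM; apply: sub_adjoin.
pose C := constant_ratfun x a cM.
have cC : divring_closed C := constant_ratfun_closed hK hx ha cM MK.
have MC : {subset M <= C} := sub_constant_ratfun x a cM.
have xC : {subset adjoin K x <= C} := adjoin_constant_ratfun hK hx ha cM aM MK.
have algC u : u \in algcl C by apply: algclS (algx u).
have [y Ey] := kval_surj hK zK.
apply/negPn/negP => zM.
have [[g [gM gy]]|fixy] := pselect (exists g : {rmorphism kbar hK -> kbar hK},
    (forall c, kval hK c \in M -> g c = c) /\ g y <> y).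
  (* An endomorphism over [M] moving [z] extends to a member of the stabilizer of [M(x)], so [z] is
     not in the stable field. *)
  have [f [fC fg fV]] := extend_constants hx algx ha cM hM aM MK gM.
  have /stable_fieldP zN : z \in stable_field v C.
    apply: zH; first exact: stable_field_closed.
    - by move=> c /xC; apply: sub_stable_field.
    - by move=> c _; apply: algx.
    - exact: stable_field_henselian.
  apply: gy; apply: (@kval_inj _ K hK); rewrite -fg Ey; apply: zN; split=> //.
(* Otherwise [z] is fixed by every endomorphism over [M(x)] without lying in it, and some henselian
   field avoids [z]. *)
have zC : z \notin C by apply: contra zM; apply: (constant_ratfun_mem hK hx ha MK).
have [|N [cN CN /negP zN hN]] := avoiding_henselian v cC algC zC.
  move=> f fC; have [|g gE] := @kbar_endo _ K hK f; first by move=> c /KM/MC/fC.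
  rewrite -Ey -gE; congr (kval hK _); apply: contrapT => gy; apply: fixy; exists g.
  by split=> // c cMm; apply: (@kval_inj _ K hK); rewrite gE fC // MC.
by apply: zN; apply: zH => // c /xC; apply: CN.
Qed.

(* Omega is the algebraic closure of Kbar(x), where Kbar = algcl K is the
   algebraic closure of K in Omega; the valuations nu of K, omega of K(x) and
   omega-bar of Kbar(x) are the restrictions of v. *)
Theorem theorem1p1 (Omega : closedFieldType) (Gamma : oagType)
    (v : valuation Omega Gamma) (K : {pred Omega}) (x a b1 b2 : Omega)
    (gamma : Gamma)
    (hK : GRing.divring_closed K)
    (hx : x \notin algcl K)
    (hOmega : forall z : Omega, z \in algcl (adjoin K x))
    (homega : valuation_transcendental v K (adjoin K x))
    (ha : minimal_pair_of_definition v K x a gamma)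
    (hb1 : b1 \in algcl K) (hb2 : b2 \in algcl K)
    (hKb1 : adjoin K b1 =i [predI adjoin K a & inertia_field v K])
    (hKb2 : adjoin K b2 =i [predI adjoin K a & ramification_field v K]) :
  (residue_transcendental v K (adjoin K x) ->
     {subset henselization v (adjoin K b1) <= implicit_constant_field v K x} /\
     {subset implicit_constant_field v K x <= henselization v (adjoin K a)}) /\
  (value_transcendental v K (adjoin K x) ->
     {subset henselization v (adjoin K b2) <= implicit_constant_field v K x} /\
     {subset implicit_constant_field v K x <= henselization v (adjoin K a)}).
Proof.
have ba1 : b1 \in adjoin K a by have := adjoin_id K b1; rewrite hKb1 => /andP[].
have ba2 : b2 \in adjoin K a by have := adjoin_id K b2; rewrite hKb2 => /andP[].
have br1 : b1 \in ramification_field v K.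
  by apply: inertia_ramification => //; have := adjoin_id K b1; rewrite hKb1 => /andP[].
have br2 : b2 \in ramification_field v K.
  by have := adjoin_id K b2; rewrite hKb2 => /andP[].
have incl := constants_henselization hK hx hOmega ha.
by split=> _; split=> //; apply: (henselization_constants hK hOmega ha).
Qed.
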